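(* Let $X=L^1(\mu)$, where $\mu$ is an arbitrary non-negative $\sigma$-additive measure, and let $A\subset X$ be a bounded set. Then $\omega(A)=\operatorname{wk}_X(A)=\operatorname{wck}_X(A)$.
   Context: Banach spaces are real or complex. For nonempty subsets $A,B$ of a Banach space, $\operatorname{d}(A,B)=\inf\{\|a-b\|:a\in A,b\in B\}$ and $\widehat{\operatorname{d}}(A,B)=\sup\{\operatorname{d}(a,B):a\in A\}$. For a bounded subset $A$ of a Banach space $X$ (canonically embedded in $X^{**}$): - $\omega(A)=\inf\{\widehat{\operatorname{d}}(A,K):\emptyset\ne K\subset X\text{ is weakly compact}\}$; - $\operatorname{wk}_X(A)=\widehat{\operatorname{d}}(\overline{A}^{w^*},X)$, where $\overline{A}^{w^*}$ is the weak$^*$ closure of $A$ in $X^{**}$; - $\operatorname{wck}_X(A)=\sup\{\operatorname{d}(\operatorname{clust}_{X^{**}}(x_k),X):(x_k)\text{ is a sequence in }A\}$, where $\operatorname{clust}_{X^{**}}(x_k)$ is the set of all weak$^*$ cluster points of $(x_k)$ in $X^{**}$. *)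

(* Defs.v *)
From HB Require Import structures.
From mathcomp Require Import all_boot all_order all_algebra.
From mathcomp Require Import complex.
From mathcomp Require Import all_classical all_reals all_analysis.
From mathcomp Require Import measurable_realfun.

Set Implicit Arguments.
Unset Strict Implicit.
Unset Printing Implicit Defensive.
Import Order.TTheory GRing.Theory Num.Theory.
Import numFieldNormedType.Exports.
Local Open Scope classical_set_scope.
Local Open Scope ring_scope.

Inductive scalars := RealScalars | ComplexScalars.

Definition scalarField (R : realType) (k : scalars) : numFieldType :=
  match k with
  | RealScalars => R
  | ComplexScalars => R[i]
  end.

Section scalar_theory.
Context {R : realType} {k : scalars}.
Local Notation K := (scalarField R k).

Definition sre : K -> R :=
  match k return scalarField R k -> R with
  | RealScalars => fun x => x
  | ComplexScalars => fun z => complex.Re z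
  end.

Definition sim : K -> R :=
  match k return scalarField R k -> R with
  | RealScalars => fun _ => 0
  | ComplexScalars => fun z => complex.Im z
  end.

(* The embedding of the real numbers into the scalar field. *)
Definition sreal : R -> K :=
  match k return R -> scalarField R k with
  | RealScalars => fun x => x
  | ComplexScalars => fun x => Complex x 0
  end.

(* The library norms take values in the scalar field, in [R[i]] for complex
   spaces; [rnorm] is the same norm as an element of [R]. *)
Definition rnorm (V : normedZmodType K) (x : V) : R := sre `|x|.
End scalar_theory.
Arguments sre {R} k x : rename.
Arguments sim {R} k x : rename.
Arguments sreal {R} k x : rename.

Section scalar_lemmas.
Context {R : realType} {k : scalars}.
Local Notation K := (scalarField R k).
Implicit Types x y : K.

Lemma sreD x y : sre k (x + y) = sre k x + sre k y.
Proof. by move: x y; case: k => // -[a b] [c d]. Qed.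

Lemma simD x y : sim k (x + y) = sim k x + sim k y.
Proof. by move: x y; case: k => [? ?|[a b] [c d]] //=; rewrite addr0. Qed.

Lemma sreM x y : sre k (x * y) = sre k x * sre k y - sim k x * sim k y.
Proof. by move: x y; case: k => [? ?|[a b] [c d]] //=; rewrite mul0r subr0. Qed.

Lemma simM x y : sim k (x * y) = sre k x * sim k y + sim k x * sre k y.
Proof.
by move: x y; case: k => [? ?|[a b] [c d]] //=; rewrite mulr0 mul0r addr0.
Qed.

Lemma sre0 : sre k (0 : K) = 0. Proof. by case: k. Qed.
Lemma sim0 : sim k (0 : K) = 0. Proof. by case: k. Qed.

Lemma srealK : cancel (@sreal R k) (sre k). Proof. by case: k. Qed.

Lemma sreal0 : sreal k (0 : R) = 0. Proof. by case: k. Qed.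

Lemma srealD (a b : R) : sreal k (a + b) = sreal k a + sreal k b.
Proof. by case: k => //; apply/eqP; rewrite eq_complex/= addr0 !eqxx. Qed.

Lemma srealM (a b : R) : sreal k (a * b) = sreal k a * sreal k b.
Proof.
by case: k => //; apply/eqP; rewrite eq_complex/= !mulr0 mul0r subr0 addr0 !eqxx.
Qed.

Lemma ler_sreal (a b : R) : (sreal k a <= sreal k b) = (a <= b).
Proof. by case: k => //; rewrite lecE/= eqxx. Qed.

Lemma ge0_sreK x : 0 <= x -> sreal k (sre k x) = x.
Proof. by move: x; case: k => //= -[a b]; rewrite lecE/= => /andP[/eqP -> _]. Qed.

Lemma ler_sre x y : x <= y -> sre k x <= sre k y.
Proof.
by move: x y; case: k => //= -[a b] [c d]; rewrite lecE/= => /andP[].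
Qed.

Lemma snormE x : rnorm x = Num.sqrt (sre k x ^+ 2 + sim k x ^+ 2).
Proof.
rewrite /rnorm; move: x; case: k => [x|[a b]] //=.
by rewrite expr0n addr0 sqrtr_sqr.
Qed.

Lemma snorm_le x : rnorm x <= `|sre k x| + `|sim k x|.
Proof.
rewrite snormE -[leRHS]ger0_norm ?addr_ge0// -sqrtr_sqr.
rewrite ler_wsqrtr// sqrrD !real_normK ?num_real//.
by rewrite lerD2r lerDl mulrn_wge0// mulr_ge0.
Qed.

Lemma srnormM x y : rnorm (x * y) = rnorm x * rnorm y.
Proof.
rewrite /rnorm normrM -[LHS](srealK) ge0_sreK ?mulr_ge0//.
by rewrite -[in LHS](ge0_sreK (normr_ge0 x)) -[in LHS](ge0_sreK (normr_ge0 y))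
  -srealM srealK.
Qed.

Variable V : normedZmodType K.
Implicit Types u v : V.

Lemma rnormK u : sreal k (rnorm u) = `|u|.
Proof. exact: ge0_sreK. Qed.

Lemma rnorm_ge0 u : 0 <= rnorm u.
Proof. by rewrite -(ler_sreal) sreal0 rnormK. Qed.

Lemma rnormD u v : rnorm (u + v) <= rnorm u + rnorm v.
Proof. by rewrite -ler_sreal srealD !rnormK ler_normD. Qed.

Lemma rnorm0 : rnorm (0 : V) = 0.
Proof. by rewrite /rnorm normr0 sre0. Qed.

Lemma rnorm_eq0 u : rnorm u = 0 -> u = 0.
Proof. by move=> u0; apply/normr0_eq0; rewrite -rnormK u0 sreal0. Qed.

End scalar_lemmas.

Lemma rnormZ {R : realType} {k : scalars} (V : normedModType (scalarField R k))
  (a : scalarField R k) (u : V) : rnorm (a *: u) = rnorm a * rnorm u.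
Proof.
by apply: (can_inj (@srealK R k)); rewrite srealM !rnormK normrZ.
Qed.

(* The topological dual: continuous [K]-linear functionals, with the operator
   norm (over the closed unit ball). *)
Section dual.
Context {R : realType} {k : scalars}.
Local Notation K := (scalarField R k).
Variable V : normedModType K.

Definition dual_pred : {pred V -> K^o} :=
  mem [set f : V -> K^o | linear f /\ continuous f].

Lemma dual_predP f : reflect (linear f /\ continuous f) (f \in dual_pred).
Proof. by apply: (iffP idP); rewrite inE. Qed.

Lemma dual_submod_closed : submod_closed dual_pred.
Proof.
split.
  apply/dual_predP; split; first by move=> a u v; rewrite /= scaler0 addr0.
  by move=> x; exact: cvg_cst.
move=> a f g /dual_predP[lf cf] /dual_predP[lg cg]; apply/dual_predP; split.
  move=> b u v; rewrite !fctE/= lf lg !scalerDr !scalerA (mulrC a b).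
  by rewrite addrACA.
move=> x; apply: cvgD; last exact: cg.
by apply: cvgZr; exact: cf.
Qed.

HB.instance Definition _ := GRing.isSubmodClosed.Build K (V -> K^o) dual_pred
  dual_submod_closed.

Record dual : Type := Dual { dual_fun :> V -> K^o ; _ : dual_fun \in dual_pred }.

HB.instance Definition _ := [isSub for dual_fun].
HB.instance Definition _ := [Choice of dual by <:].
HB.instance Definition _ := [SubChoice_isSubLmodule of dual by <:].

Lemma dual_linear (f : dual) : linear f.
Proof. by have /dual_predP[] := valP f. Qed.

HB.instance Definition _ (f : dual) :=
  GRing.isLinear.Build K V K^o _ f (dual_linear f).

Lemma dual_continuous (f : dual) : continuous f.
Proof. by have /dual_predP[] := valP f. Qed.

Implicit Types f g : dual.

Definition dual_norm (f : dual) : R :=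
  sup [set rnorm (f x) | x in [set x : V | rnorm x <= 1]].

Lemma dual_bounded (f : dual) :
  exists2 M, 0 <= M & forall x, rnorm (f x) <= M * rnorm x.
Proof.
have /linear_bounded_continuous/linear_boundedP[M [Mr fM]] : continuous f.
  exact: dual_continuous.
have M1 : M < `|M| + 1.
  by rewrite (le_lt_trans (real_ler_norm Mr))// ltrDl.
exists (sre k (`|M| + 1)).
  by rewrite -(@ler_sreal R k) sreal0 ge0_sreK ?addr_ge0.
move=> x; rewrite -(@ler_sreal R k) srealM !rnormK ge0_sreK ?addr_ge0//.
exact: fM.
Qed.

Lemma dual_norm_has_sup (f : dual) :
  has_sup [set rnorm (f x) | x in [set x : V | rnorm x <= 1]].
Proof.
split; first by exists (rnorm (f 0)), 0 => //=; rewrite rnorm0.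
have [M M0 fM] := dual_bounded f; exists M => _ [x x1 <-].
by rewrite (le_trans (fM x))// ler_piMr.
Qed.

Lemma dual_norm_ge0 f : 0 <= dual_norm f.
Proof.
rewrite (le_trans (rnorm_ge0 (f 0)))//; apply: sup_upper_bound.
  exact: dual_norm_has_sup.
by exists 0 => //=; rewrite rnorm0.
Qed.

Lemma dual_normP f x : rnorm (f x) <= dual_norm f * rnorm x.
Proof.
have [x0|x0] := eqVneq (rnorm x) 0.
  by rewrite x0 mulr0 (rnorm_eq0 x0) linear0 rnorm0.
have {}x0 : 0 < rnorm x by rewrite lt_neqAle eq_sym x0 rnorm_ge0.
pose a : K := sreal k (rnorm x)^-1.
have a0 : rnorm a = (rnorm x)^-1.
  rewrite /rnorm ger0_norm ?srealK// -sreal0 ler_sreal.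
  by rewrite invr_ge0 ltW.
have : rnorm (f (a *: x)) <= dual_norm f.
  apply: sup_upper_bound; first exact: dual_norm_has_sup.
  by exists (a *: x) => //=; rewrite rnormZ a0 mulVf// gt_eqF.
by rewrite linearZ/= rnormZ a0 mulrC ler_pdivrMr.
Qed.

Lemma dual_norm_le f M : 0 <= M ->
  (forall x, rnorm (f x) <= M * rnorm x) -> dual_norm f <= M.
Proof.
move=> M0 fM; apply: ge_sup; first by have [] := dual_norm_has_sup f.
by move=> _ [x x1 <-]; rewrite (le_trans (fM x))// ler_piMr.
Qed.

Let norm (f : dual) : K := sreal k (dual_norm f).

Let ler_normD f g : norm (f + g) <= norm f + norm g.
Proof.
rewrite /norm -srealD ler_sreal; apply: dual_norm_le => [|x].
  by rewrite addr_ge0// dual_norm_ge0.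
by rewrite mulrDl (le_trans (rnormD _ _))// lerD// dual_normP.
Qed.

Let normrZ_le (a : K) f : dual_norm (a *: f) <= rnorm a * dual_norm f.
Proof.
apply: dual_norm_le => [|x]; first by rewrite mulr_ge0 ?rnorm_ge0 ?dual_norm_ge0.
by rewrite [X in rnorm X]/(a *: f x) rnormZ -mulrA ler_wpM2l ?rnorm_ge0 ?dual_normP.
Qed.

Let normr0_eq0 f : norm f = 0 -> f = 0.
Proof.
rewrite /norm -[RHS]/(0 : K) -(@sreal0 R k) => /(can_inj (@srealK R k)) f0.
apply/val_inj/funext => x /=; apply: rnorm_eq0.
by apply/eqP; rewrite eq_le rnorm_ge0 andbT (le_trans (dual_normP f x))// f0 mul0r.
Qed.

Let normrZ (a : K) f : norm (a *: f) = `|a| * norm f.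
Proof.
rewrite /norm -[`|a|]rnormK -srealM; congr (sreal k _).
apply/eqP; rewrite eq_le normrZ_le/=.
have [->|a0] := eqVneq a 0.
  by rewrite rnorm0 mul0r dual_norm_ge0.
have ra : 0 < rnorm a.
  by rewrite lt_neqAle rnorm_ge0 andbT eq_sym; apply: contra_neq a0 => /rnorm_eq0.
rewrite -ler_pdivlMl//.
have -> : (rnorm a)^-1 = rnorm (a^-1).
  apply: (mulfI (lt0r_neq0 ra)); rewrite mulfV ?gt_eqF// -srnormM mulfV//.
  by rewrite /rnorm normr1; case: (k).
by rewrite -[f in leLHS]scale1r -(mulVf a0) -scalerA normrZ_le.
Qed.

HB.instance Definition _ := Lmodule_isNormed.Build K dual
  ler_normD normrZ normr0_eq0.

End dual.

(* The canonical embedding of [V] into its bidual. *)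
Section bidual.
Context {R : realType} {k : scalars}.
Local Notation K := (scalarField R k).
Variable V : normedModType K.

Let eval (x : V) : dual V -> K^o := fun f => f x.

Let eval_linear x : linear (eval x). Proof. by []. Qed.

HB.instance Definition _ (x : V) :=
  GRing.isLinear.Build K (dual V) K^o _ (eval x) (eval_linear x).

Lemma eval_dual (x : V) : (fun f : dual V => f x : K^o) \in @dual_pred R k (dual V).
Proof.
apply/dual_predP; split; first exact: eval_linear.
apply: (@bounded_linear_continuous _ _ _ (eval x)).
apply/linear_boundedP; exists `|x|; split; first exact: normr_real.
move=> M xM f; rewrite (le_trans _ (ler_wpM2r (normr_ge0 f) (ltW xM)))//.
rewrite -!rnormK -srealM ler_sreal mulrC /rnorm srealK.
exact: dual_normP.
Qed.

Definition bidual_emb (x : V) : dual (dual V) := Dual (eval_dual x).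

End bidual.

(* [weak V] and [weakstar V] are copies of [V] and of [dual V] with the initial
   topologies for all the evaluations, i.e. the topologies induced by pointwise
   convergence on [dual V], respectively on [V]. *)
Section weak_topologies.
Context {R : realType} {k : scalars}.
Local Notation K := (scalarField R k).
Variable V : normedModType K.

Definition weak : Type :=
  initial_topology (fun x : V => (fun f => f x) : {ptws dual V -> K^o}).
HB.instance Definition _ := Topological.on weak.

Definition weakstar : Type :=
  initial_topology (fun f : dual V => (f : V -> K^o) : {ptws V -> K^o}).
HB.instance Definition _ := Topological.on weakstar.

End weak_topologies.

(* Distances are extended real numbers: those of nonempty sets are finite or,
   for [hatdist], [+oo] when there is no bound; [hatdist set0 B = -oo]. *)
Section distances.
Context {R : realType} {k : scalars}.
Variable V : normedModType (scalarField R k).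
Implicit Types A B : set V.

Definition setdist A B : \bar R :=
  ereal_inf [set (rnorm (a - b))%:E | a in A & b in B].

Definition hatdist A B : \bar R :=
  ereal_sup [set setdist [set a] B | a in A].

End distances.

Section weak_noncompactness.
Context {R : realType} {k : scalars}.
Variable X : normedModType (scalarField R k).
Implicit Types A : set X.

Definition weakly_compact (C : set X) := @compact (weak X) C.

Definition omega A : \bar R :=
  ereal_inf [set hatdist A C | C in [set C | C !=set0 /\ weakly_compact C]].

Definition weakstar_closure (A : set (dual (dual X))) : set (dual (dual X)) :=
  @closure (weakstar (dual X)) A.

Definition wk A : \bar R :=
  hatdist (weakstar_closure (@bidual_emb R k X @` A)) (range (@bidual_emb R k X)).

Definition clust (x : nat -> X) : set (dual (dual X)) :=
  @cluster (weakstar (dual X)) ((fun n => bidual_emb (x n)) @ \oo).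

Definition wck A : \bar R :=
  ereal_sup [set setdist (clust x) (range (@bidual_emb R k X))
    | x in [set x : nat -> X | forall n, A (x n)]].

End weak_noncompactness.

(* The space of (classes modulo equality almost everywhere of) integrable
   functions with values in the scalar field. A scalar-valued function is
   integrable when its real and imaginary parts are; the imaginary part [sim]
   is 0 for real scalars. *)
Section L1.
Context {R : realType} (k : scalars) d (T : measurableType d).
Local Notation K := (scalarField R k).
Variable mu : {measure set T -> \bar R}.

Definition L1fun_pred : {pred T -> K^o} :=
  mem [set f : T -> K^o |
    mu.-integrable setT (fun t => (sre k (f t))%:E) /\
    mu.-integrable setT (fun t => (sim k (f t))%:E)].

Lemma L1fun_predP f :
  reflect (mu.-integrable setT (fun t => (sre k (f t))%:E) /\
           mu.-integrable setT (fun t => (sim k (f t))%:E)) (f \in L1fun_pred).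
Proof. by apply: (iffP idP); rewrite inE. Qed.

Lemma L1fun_submod_closed : submod_closed L1fun_pred.
Proof.
split.
  apply/L1fun_predP; split.
  - under eq_fun do rewrite sre0; exact: integrable0.
  - under eq_fun do rewrite sim0; exact: integrable0.
move=> a f g /L1fun_predP[rf jf] /L1fun_predP[rg jg]; apply/L1fun_predP; split.
- under eq_fun do rewrite /= sreD sreM EFinD EFinB !EFinM.
  by apply: integrableD => //; apply: integrableB => //; exact: integrableZl.
- under eq_fun do rewrite /= simD simM !EFinD !EFinM.
  by apply: integrableD => //; apply: integrableD => //; exact: integrableZl.
Qed.

HB.instance Definition _ := GRing.isSubmodClosed.Build K (T -> K^o) L1fun_pred
  L1fun_submod_closed.

Record L1fun : Type :=
  MkL1fun { L1fun_val :> T -> K^o ; _ : L1fun_val \in L1fun_pred }.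

HB.instance Definition _ := [isSub for L1fun_val].
HB.instance Definition _ := [Choice of L1fun by <:].
HB.instance Definition _ := [SubChoice_isSubLmodule of L1fun by <:].

Definition L1_eq (f g : L1fun) : bool := `[< (f : T -> K^o) = g %[ae mu] >].

Let L1_eq_refl : reflexive L1_eq.
Proof. by move=> f; apply/asboolP; exact: ae_eq_refl. Qed.

Let L1_eq_sym : symmetric L1_eq.
Proof. by move=> f g; apply/asboolP/asboolP => /ae_eq_sym. Qed.

Let L1_eq_trans : transitive L1_eq.
Proof.
by move=> f g h /asboolP gf /asboolP fh; apply/asboolP; exact: ae_eq_trans fh.
Qed.

Canonical L1_eq_equiv := EquivRel L1_eq L1_eq_refl L1_eq_sym L1_eq_trans.

Local Open Scope quotient_scope.

Definition L1 : Type := {eq_quot L1_eq}.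
HB.instance Definition _ := Choice.on L1.
HB.instance Definition _ := EqQuotient.on L1.

Definition L1_repr (f : L1) : L1fun := repr f.
Coercion L1_repr : L1 >-> L1fun.

Lemma L1W (P : L1 -> Prop) : (forall f, P (\pi_L1 f)) -> forall f, P f.
Proof. by move=> Ppi f; rewrite -[f]reprK; exact: Ppi. Qed.

Lemma L1_piP (f g : L1fun) :
  \pi_L1 f = \pi_L1 g <-> (f : T -> K^o) = g %[ae mu].
Proof.
split=> [/eqmodP h|h]; first exact/asboolP.
by apply/eqmodP/asboolP.
Qed.

Lemma L1_piK (f : L1fun) : (L1_repr (\pi_L1 f) : T -> K^o) = f %[ae mu].
Proof. by apply/L1_piP; rewrite [LHS]reprK. Qed.

Let L1zero : L1 := \pi_L1 0.
Let L1opp (f : L1) : L1 := \pi_L1 (- (f : L1fun)).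
Let L1add (f g : L1) : L1 := \pi_L1 ((f : L1fun) + (g : L1fun)).
Let L1scale (a : K) (f : L1) : L1 := \pi_L1 (a *: (f : L1fun)).

Let piD f g : L1add (\pi_L1 f) (\pi_L1 g) = \pi_L1 (f + g).
Proof.
apply/L1_piP; apply: filterS2 (L1_piK f) (L1_piK g) => t /= ft gt _.
by rewrite !fctE ft// gt.
Qed.

Let piN f : L1opp (\pi_L1 f) = \pi_L1 (- f).
Proof. by apply/L1_piP; apply: filterS (L1_piK f) => t /= ft _; rewrite !fctE ft. Qed.

Let piZ a f : L1scale a (\pi_L1 f) = \pi_L1 (a *: f).
Proof. by apply/L1_piP; apply: filterS (L1_piK f) => t /= ft _; rewrite !fctE ft. Qed.

Let L1addA : associative L1add.
Proof.
move=> f g h; elim/L1W: f => f; elim/L1W: g => g; elim/L1W: h => h.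
by rewrite !piD addrA.
Qed.

Let L1addC : commutative L1add.
Proof.
by move=> f g; elim/L1W: f => f; elim/L1W: g => g; rewrite !piD addrC.
Qed.

Let L1add0 : left_id L1zero L1add.
Proof. by move=> f; elim/L1W: f => f; rewrite piD add0r. Qed.

Let L1addN : left_inverse L1zero L1opp L1add.
Proof. by move=> f; elim/L1W: f => f; rewrite piN piD addNr. Qed.

HB.instance Definition _ := GRing.isZmodule.Build L1
  L1addA L1addC L1add0 L1addN.

Let L1scaleA a b f : L1scale a (L1scale b f) = L1scale (a * b) f.
Proof. by elim/L1W: f => f; rewrite !piZ scalerA. Qed.

Let L1scale1 : left_id 1 L1scale.
Proof. by move=> f; elim/L1W: f => f; rewrite piZ scale1r. Qed.

Let L1scaleDr : right_distributive L1scale +%R.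
Proof.
move=> a f g; elim/L1W: f => f; elim/L1W: g => g.
by rewrite [_ + _]piD !piZ [RHS]piD scalerDr.
Qed.

Let L1scaleDl f : {morph L1scale^~ f : a b / a + b}.
Proof.
by move=> a b; elim/L1W: f => f; rewrite !piZ [RHS]piD scalerDl.
Qed.

HB.instance Definition _ := GRing.Zmodule_isLmodule.Build K L1
  L1scaleA L1scale1 L1scaleDr L1scaleDl.

Lemma L1_piD f g : \pi_L1 f + \pi_L1 g = \pi_L1 (f + g).
Proof. exact: piD. Qed.

Lemma L1_piZ a f : a *: \pi_L1 f = \pi_L1 (a *: f).
Proof. exact: piZ. Qed.

Lemma L1fun_integrable (f : L1fun) :
  mu.-integrable setT (fun t => (rnorm (f t))%:E).
Proof.
have /L1fun_predP[rf jf] := valP f.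
apply: (@le_integrable _ _ _ mu setT measurableT _
  (fun t => (`|sre k (f t)| + `|sim k (f t)|)%:E)) => //.
- have /measurable_EFinP mr := measurable_int mu rf.
  have /measurable_EFinP mi := measurable_int mu jf.
  apply/measurable_EFinP; under eq_fun do rewrite snormE.
  apply: (measurableT_comp (continuous_measurable_fun (@sqrt_continuous R))).
  by apply: measurable_funD; exact: measurable_funX.
- move=> t _; rewrite !abse_EFin lee_fin (ger0_norm (rnorm_ge0 _)).
  by rewrite ger0_norm ?addr_ge0//; exact: snorm_le.
- under eq_fun do rewrite EFinD.
  by apply: integrableD => //; exact: integrable_norm.
Qed.

Definition L1norm (f : L1) : R := \int[mu]_t rnorm (f t).

Lemma L1norm_pi (f : L1fun) : L1norm (\pi_L1 f) = \int[mu]_t rnorm (f t).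
Proof.
congr fine; apply: ae_eq_integral => //.
- exact: measurable_int (L1fun_integrable _).
- exact: measurable_int (L1fun_integrable _).
- by apply: filterS (L1_piK f) => t /= ft _; rewrite ft.
Qed.

Let norm (f : L1) : K := sreal k (L1norm f).

Let ler_normD f g : norm (f + g) <= norm f + norm g.
Proof.
rewrite /norm -srealD ler_sreal.
elim/L1W: f => f; elim/L1W: g => g; rewrite L1_piD !L1norm_pi.
rewrite -RintegralD//; [|exact: L1fun_integrable..].
apply: le_Rintegral => //; first exact: L1fun_integrable.
- exact: (integrableD measurableT (L1fun_integrable f) (L1fun_integrable g)).
- by move=> t _; exact: rnormD.
Qed.

Let normrZ (a : K) f : norm (a *: f) = `|a| * norm f.
Proof.
rewrite /norm -[`|a|]rnormK -srealM; congr (sreal k _).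
elim/L1W: f => f; rewrite L1_piZ !L1norm_pi.
rewrite -RintegralZl//; last exact: L1fun_integrable.
by apply: eq_Rintegral => t _; rewrite -srnormM.
Qed.

Let normr0_eq0 f : norm f = 0 -> f = 0.
Proof.
rewrite /norm -[RHS](@sreal0 R k) => /(can_inj (@srealK R k)).
elim/L1W: f => f; rewrite L1norm_pi => f0; apply/L1_piP.
have fi := L1fun_integrable f.
have : (\int[mu]_t `|(rnorm (f t))%:E| = 0)%E.
  under eq_integral do rewrite gee0_abs ?lee_fin ?rnorm_ge0//.
  by rewrite -(fineK (integrable_fin_num _ fi))// [fine _]f0.
move/(ae_eq_integral_abs _ measurableT (measurable_int mu fi)).
by apply: filterS => t /= /(_ I)[] /rnorm_eq0.
Qed.

HB.instance Definition _ := Lmodule_isNormed.Build K L1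
  ler_normD normrZ normr0_eq0.

End L1.

(* Main.v *)
From HB Require Import structures.
Require Import Defs.
From mathcomp Require Import all_boot all_order all_algebra.
From mathcomp Require Import complex.
From mathcomp Require Import all_classical all_reals all_analysis.
From mathcomp Require Import measurable_realfun.
From mathcomp Require Import ring lra.

Set Implicit Arguments.
Unset Strict Implicit.
Unset Printing Implicit Defensive.
Import Order.TTheory GRing.Theory Num.Theory.
Import numFieldNormedType.Exports.
Local Open Scope classical_set_scope.
Local Open Scope ring_scope.

(** In every normed space [wck A <= wk A <= omega A] for bounded [A]. The first
    inequality ([wck_le_wk]) holds because a sequence in [A] has weak* cluster
    points, all of which lie in the weak* closure of [A]. The second ([wk_le_omega])
    holds because a point of the weak* closure of [A] is a weak* limit along an
    ultrafilter, and weak* lower semicontinuity of the norm transfers the distance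
    to a weakly compact set. The content of the theorem is [omega A <= wck A] in
    [L1] ([omega_le_wck]), for which let [c < omega A].

    Order intervals, that is sets [|f| <= g] with [g] integrable, are weakly
    compact ([order_interval_weakly_compact]), and the distance of [f] to one
    is at most the integral of [(|f| - g)^+]. So for every [g] some [f] in [A] has
    this integral above [c]. Choosing each [g] as a huge multiple of the sum of the
    absolute values of the functions already chosen gives a sequence [f n] in [A]
    and sets [E n] such that [f n] has mass at least [c] on [E n] while all earlier
    functions have tiny mass there ([humps_exist]).

    From such humps one builds bounded test functions [h] with
    [|int f n h| >= c - 4 eps] for all [n] ([gliding_hump]): on [E n] minus the later
    sets, [h] is the conjugate phase of [f n] times a sign, and the signs are chosen
    one after the other so that the hump of [f n] does not cancel the contribution
    of the earlier ones. If only humps of index at least [m] are used, the supports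
    decrease to the empty set as [m] grows, so [int g h] tends to 0 for
    each fixed [g] in [L1]. Thus every weak* cluster point of the sequence is at
    distance at least [c - 4 eps] from every [g] ([humps_dist_clust]). *)

(** * Scalars *)

Section scalars.
Context {R : realType} {k : scalars}.
Local Notation K := (scalarField R k).

Definition sscal (a b : R) : K :=
  match k return scalarField R k with
  | RealScalars => a
  | ComplexScalars => Complex a b
  end.

Lemma sre_sscal a b : sre k (sscal a b) = a.
Proof. by rewrite /sscal; case: (k). Qed.

Lemma sscalE (x : K) : sscal (sre k x) (sim k x) = x.
Proof. by rewrite /sscal; move: x; case: (k) => // -[]. Qed.

Lemma scalarP (x y : K) : sre k x = sre k y -> sim k x = sim k y -> x = y.
Proof. by move=> h1 h2; rewrite -[x]sscalE -[y]sscalE h1 h2. Qed.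

Lemma sreN (x : K) : sre k (- x) = - sre k x.
Proof. by move: x; case: (k) => // -[]. Qed.

Lemma simN (x : K) : sim k (- x) = - sim k x.
Proof. by move: x; case: (k) => [?|[]] //=; rewrite oppr0. Qed.

Lemma sre_sreal (a : R) : sre k (sreal k a) = a. Proof. exact: srealK. Qed.

Lemma sim_sreal (a : R) : sim k (sreal k a) = 0. Proof. by case: (k). Qed.

Lemma sreal1 : sreal k (1 : R) = 1. Proof. by case: (k). Qed.

Lemma ltr_sreal (a b : R) : (sreal k a < sreal k b) = (a < b).
Proof. by case: (k) => //; rewrite ltcE/= eqxx. Qed.

Lemma rnorm_sreal (a : R) : rnorm (sreal k a) = `|a|.
Proof. by rewrite snormE sre_sreal sim_sreal expr0n addr0 sqrtr_sqr. Qed.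

Lemma rnorm_sqr (x : K) : rnorm x ^+ 2 = sre k x ^+ 2 + sim k x ^+ 2.
Proof. by rewrite snormE sqr_sqrtr// addr_ge0// sqr_ge0. Qed.

Lemma sre_le_rnorm (x : K) : `|sre k x| <= rnorm x.
Proof. by rewrite snormE -sqrtr_sqr ler_wsqrtr// lerDl sqr_ge0. Qed.

Lemma sim_le_rnorm (x : K) : `|sim k x| <= rnorm x.
Proof. by rewrite snormE -sqrtr_sqr ler_wsqrtr// lerDr sqr_ge0. Qed.

Lemma rnormN (V : normedZmodType K) (u : V) : rnorm (- u) = rnorm u.
Proof. by rewrite /rnorm normrN. Qed.

Lemma rnormBC (V : normedZmodType K) (u v : V) : rnorm (u - v) = rnorm (v - u).
Proof. by rewrite /rnorm distrC. Qed.

Lemma rnormB (V : normedZmodType K) (u v : V) : rnorm (u - v) <= rnorm u + rnorm v.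
Proof. by rewrite (le_trans (rnormD _ _))// rnormN. Qed.

Lemma rnorm_gt0 (V : normedZmodType K) (u : V) : u != 0 -> 0 < rnorm u.
Proof.
by move=> u0; rewrite lt_neqAle rnorm_ge0 andbT eq_sym;
  apply: contra_neq u0 => /rnorm_eq0.
Qed.

Lemma rnorm_distD (V : normedZmodType K) (w u v : V) :
  rnorm (u - v) <= rnorm (u - w) + rnorm (w - v).
Proof. by rewrite -{1}(subrK w u) -addrA rnormD. Qed.

(** The conjugate of the unimodular part of [x], written without conjugation so
    that it makes sense for both kinds of scalars. *)
Definition sphase (x : K) : K := `|x| / x.

Lemma sphaseM (x : K) : sphase x * x = sreal k (rnorm x).
Proof.
rewrite rnormK /sphase; have [->|x0] := eqVneq x 0; first by rewrite mulr0 normr0.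
by rewrite divfK.
Qed.

Lemma rnorm_sphase (x : K) : rnorm (sphase x) <= 1.
Proof.
rewrite /sphase /rnorm normf_div normr_id.
have [->|x0] := eqVneq x 0; first by rewrite normr0 mul0r sre0 ler01.
by rewrite divff ?normr_eq0// -sreal1 srealK.
Qed.

(** The formula in coordinates is what gives measurability. *)
Lemma sphaseE (x : K) :
  sphase x = sscal (sre k x / rnorm x) (- (sim k x / rnorm x)).
Proof.
have [->|x0] := eqVneq x 0.
  rewrite /sphase normr0 mul0r; apply: scalarP; first by rewrite sre_sscal !sre0 mul0r.
  by rewrite /sscal; case: (k) => //=; rewrite mul0r oppr0.
have n0 : rnorm x != 0 by rewrite gt_eqF// rnorm_gt0.
apply: (mulIf x0); rewrite sphaseM; apply: scalarP.
  rewrite sre_sreal sreM sre_sscal.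
  have -> : sim k (sscal (sre k x / rnorm x) (- (sim k x / rnorm x))) =
      - (sim k x / rnorm x).
    by rewrite /sscal; case: (k) x {x0 n0} => //= x; rewrite mul0r oppr0.
  by apply: (mulIf n0); rewrite -expr2 rnorm_sqr; field.
rewrite sim_sreal simM sre_sscal.
have -> : sim k (sscal (sre k x / rnorm x) (- (sim k x / rnorm x))) =
    - (sim k x / rnorm x).
  by rewrite /sscal; case: (k) x {x0 n0} => //= x; rewrite mul0r oppr0.
by ring.
Qed.

Lemma nbhs_rnorm (V : normedModType K) (x : V) (B : set V) :
  nbhs x B <-> exists2 e : R, 0 < e & forall y, rnorm (y - x) < e -> B y.
Proof.
split=> [/nbhs_ballP[e /= e0 eB]|[e e0 eB]].
  have eE : sreal k (sre k e) = e by rewrite ge0_sreK ?ltW.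
  exists (sre k e); first by rewrite -ltr_sreal eE sreal0.
  move=> y ye; apply: eB.
  by rewrite -ball_normE/= distrC -rnormK -eE ltr_sreal.
apply/nbhs_ballP; exists (sreal k e) => /=; first by rewrite -sreal0 ltr_sreal.
by move=> y; rewrite -ball_normE/= distrC -rnormK ltr_sreal => /eB.
Qed.

Lemma cvg_rnorm (V : normedModType K) (I : Type) (F : set_system I)
    (w : I -> V) (l : V) : Filter F ->
  (w @ F --> l) <-> (forall e : R, 0 < e -> F [set i | rnorm (w i - l) < e]).
Proof.
move=> FF; split=> [wl e e0|wl B /nbhs_rnorm[e e0 eB]].
  by apply: (wl [set y | rnorm (y - l) < e]); apply/nbhs_rnorm; exists e.
by apply: (filterS _ (wl _ e0)) => i; exact: eB.
Qed.

Lemma ultra_fmap (I J : Type) (U : set_system I) (f : I -> J) :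
  UltraFilter U -> UltraFilter (f @ U).
Proof.
move=> UU; split; first exact: fmap_proper_filter.
move=> G PG UG; apply/seteqP; split=> // A GA.
have [//|nA] := in_ultra_setVsetC (f @^-1` A) UU.
have : G (A `&` ~` A) by apply: filterI => //; exact: UG.
by rewrite setICr => /filter_ex[].
Qed.

Lemma real_ultra_cvg (I : Type) (U : set_system I) (w : I -> R) (M : R) :
  UltraFilter U -> U [set i | `|w i| <= M] ->
  exists l : R, forall e : R, 0 < e -> U [set i | `|w i - l| < e].
Proof.
move=> UU UM.
have := @segment_compact R (- M) M; rewrite compact_ultra => /(_ (w @ U)).
case.
  exact: ultra_fmap.
  change (U (w @^-1` `[- M, M])).
  by apply: filterS UM => i /=; rewrite in_itv/= ler_norml.

move=> l [_ /= wl]; exists l => e e0.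
by move/cvgrPdist_lt : wl => /(_ _ e0); apply: filterS => i /=; rewrite distrC.
Qed.

(** Limits of scalars are handled below in epsilon form with the real-valued norm
    [rnorm], since the norm [`|x|] of a complex scalar is itself a complex scalar. *)
Lemma scalar_cvg_parts (I : Type) (F : set_system I) (w : I -> K) (a b : R) : Filter F ->
  (forall e : R, 0 < e -> F [set i | `|sre k (w i) - a| < e]) ->
  (forall e : R, 0 < e -> F [set i | `|sim k (w i) - b| < e]) ->
  forall e : R, 0 < e -> F [set i | rnorm (w i - sscal a b) < e].
Proof.
move=> FF wa wb e e0; have e2 : 0 < e / 2 by rewrite divr_gt0.
apply: filterS2 (wa _ e2) (wb _ e2) => i /= h1 h2.
rewrite (le_lt_trans (snorm_le _))// (splitr e) ltr_leD//.
  by rewrite sreD sreN sre_sscal.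
rewrite simD simN /sscal; move: (k) w {wa wb h1} h2; case => //= w h2.
  by rewrite oppr0 addr0 normr0 ltW.
exact: ltW.
Qed.

Lemma scalar_ultra_cvg (I : Type) (U : set_system I) (w : I -> K) (M : R) :
  UltraFilter U -> U [set i | rnorm (w i) <= M] ->
  exists l : K, forall e : R, 0 < e -> U [set i | rnorm (w i - l) < e].
Proof.
move=> UU UM.
have [a wa] : exists a : R, forall e : R, 0 < e -> U [set i | `|sre k (w i) - a| < e].
  apply: (@real_ultra_cvg _ _ _ M) => //.
  by apply: filterS UM => i; exact/le_trans/sre_le_rnorm.
have [b wb] : exists b : R, forall e : R, 0 < e -> U [set i | `|sim k (w i) - b| < e].
  apply: (@real_ultra_cvg _ _ _ M) => //.
  by apply: filterS UM => i; exact/le_trans/sim_le_rnorm.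
by exists (sscal a b); exact: scalar_cvg_parts.
Qed.

End scalars.

(** * Functionals and weak convergence *)

Section functionals.
Context {R : realType} {k : scalars}.
Local Notation K := (scalarField R k).

Lemma initial_cvgP (S : choiceType) (T : topologicalType) (f : S -> T)
    (F : set_system S) (t : S) : Filter F ->
  (F --> (t : initial_topology f)) <-> (f @ F --> f t).
Proof.
move=> FF; split=> [ut|ut B].
  exact: (cvg_comp _ _ ut (@initial_continuous _ _ f t)).
move=> /= [_ [[C oC <-] Ct CB]].
have FC : F (f @^-1` C) by apply: ut; apply: open_nbhs_nbhs.
exact: (filterS CB FC).
Qed.

(** Both the weak and the weak* topologies are initial topologies for a map into
    a product, so convergence is tested one coordinate at a time. *)
Lemma weak_cvgP (S : choiceType) (I : Type) (ev : S -> {ptws I -> K^o})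
    (F : set_system S) (t : S) : Filter F ->
  (F --> (t : initial_topology ev)) <->
  (forall i (e : R), 0 < e -> F [set s | rnorm (ev s i - ev t i) < e]).
Proof.
move=> FF; apply: (iff_trans (initial_cvgP _ _ _)).
apply: (iff_trans (cvg_sup _ _ _)).
split=> h i.
  have /initial_cvgP/cvg_rnorm := h i.
  exact.
apply/initial_cvgP/cvg_rnorm; exact: h.
Qed.

Lemma bounded_linear_dual (X : normedModType K) (f : X -> K) (M : R) :
  (forall a u v, f (a *: u + v) = a * f u + f v) ->
  (forall x, rnorm (f x) <= M * rnorm x) ->
  exists2 phi : dual X, (forall x, phi x = f x) & (0 <= M -> dual_norm phi <= M).
Proof.
move=> lf bf.
have cf : continuous (f : X -> K^o).
  move=> x; apply/cvg_rnorm => e e0.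
  have M1 : 0 < `|M| + 1 by rewrite ltr_wpDl.
  apply/nbhs_rnorm; exists (e / (`|M| + 1)); first by rewrite divr_gt0.
  move=> y /=; rewrite ltr_pdivlMr// => ye.
  have -> : f y - f x = f (y - x).
    have := lf (-1) x y; rewrite scaleN1r mulN1r addrC => ->.
    by rewrite addrC.
  rewrite (le_lt_trans (bf _))// (le_lt_trans _ ye)// mulrC ler_wpM2l ?rnorm_ge0//.
  by rewrite (le_trans (ler_norm _))// lerDl.
have fP : (f : X -> K^o) \in @dual_pred R k X by apply/dual_predP.
exists (Dual fP) => // M0.
exact: dual_norm_le.
Qed.

Variable X : normedModType K.

Lemma dualB (phi : dual X) (x y : X) : phi (x - y) = phi x - phi y.
Proof. exact: raddfB. Qed.

Lemma bidualB (z w : dual (dual X)) phi : (z - w) phi = z phi - w phi.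
Proof. by []. Qed.

Lemma rnorm_dualE (V : normedModType K) (phi : dual V) : rnorm phi = dual_norm phi.
Proof. exact: srealK. Qed.

Lemma filter_meets (I : Type) (F : set_system I) (A B : set I) :
  ProperFilter F -> F A -> F B -> (A `&` B) !=set0.
Proof. by move=> FF FA FB; apply: filter_ex (filterI FA FB). Qed.

Lemma scalar_cvg_norm_le (I : Type) (F : set_system I) (w : I -> K) (l : K) (M : R) :
  ProperFilter F -> (forall e : R, 0 < e -> F [set i | rnorm (w i - l) < e]) ->
  F [set i | rnorm (w i) <= M] -> rnorm l <= M.
Proof.
move=> FF wl wM; apply/ler_addgt0Pr => e e0.
have [i [/= h1 h2]] := filter_meets FF (wl _ e0) wM.
rewrite addrC -(subrK (w i) l) (le_trans (rnormD _ _))// lerD// rnormBC.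
exact: ltW.
Qed.

Lemma scalar_cvg_lin (I : Type) (F : set_system I) (a : K) (v w : I -> K) (l m : K) :
  Filter F -> (forall e : R, 0 < e -> F [set i | rnorm (v i - l) < e]) ->
  (forall e : R, 0 < e -> F [set i | rnorm (w i - m) < e]) ->
  (forall e : R, 0 < e -> F [set i | rnorm ((a * v i + w i) - (a * l + m)) < e]).
Proof.
move=> FF vl wm e e0.
have a1 : 0 < rnorm a + 1 by rewrite ltr_wpDl// rnorm_ge0.
have e2 : 0 < e / 2 by rewrite divr_gt0.
have e3 : 0 < e / 2 / (rnorm a + 1) by rewrite divr_gt0.
apply: filterS2 (vl _ e3) (wm _ e2) => i /= h1 h2.
have -> : (a * v i + w i) - (a * l + m) = a * (v i - l) + (w i - m).
  by rewrite mulrBr opprD addrACA.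
rewrite (le_lt_trans (rnormD _ _))// (splitr e) ler_ltD// srnormM.
rewrite ltr_pdivlMr// in h1; rewrite (le_trans _ (ltW h1))// mulrC ler_wpM2l ?rnorm_ge0//.
by rewrite lerDl.
Qed.

Lemma scalar_cvg_unique (I : Type) (F : set_system I) (w : I -> K) (l m : K) :
  ProperFilter F -> (forall e : R, 0 < e -> F [set i | rnorm (w i - l) < e]) ->
  (forall e : R, 0 < e -> F [set i | rnorm (w i - m) < e]) -> l = m.
Proof.
move=> FF wl wm; apply/subr0_eq/rnorm_eq0/eqP; rewrite eq_le rnorm_ge0 andbT.
apply/ler_addgt0Pr => e e0; rewrite add0r.
have e2 : 0 < e / 2 by rewrite divr_gt0.
have [i [/= h1 h2]] := filter_meets FF (wl _ e2) (wm _ e2).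
by rewrite (le_trans (rnorm_distD (w i) _ _))// (splitr e) lerD// ?(rnormBC l) ltW.
Qed.

(** Banach-Alaoglu in the form of limits along ultrafilters, which avoids
    Tychonoff's theorem: the pointwise limits of the evaluations are linear and
    bounded. *)
Lemma ultra_dual_cvg (I : Type) (U : set_system I) (u : I -> X) (M : R) :
  UltraFilter U -> U [set i | rnorm (u i) <= M] ->
  exists z : dual (dual X), forall (phi : dual X) (e : R), 0 < e ->
    U [set i | rnorm (phi (u i) - z phi) < e].
Proof.
move=> UU UM.
have bd (phi : dual X) : U [set i | rnorm (phi (u i)) <= M * rnorm phi].
  apply: filterS UM => i /= uM; rewrite (le_trans (dual_normP _ _))// mulrC rnorm_dualE.
  by rewrite ler_wpM2r ?dual_norm_ge0.
have /choice[z zP] (phi : dual X) : exists l : K, forall e : R, 0 < e ->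
    U [set i | rnorm (phi (u i) - l) < e] by exact: scalar_ultra_cvg (bd phi).
have [||zz zzE _] := @bounded_linear_dual (dual X) z M.
- move=> a f g; apply: scalar_cvg_unique (zP _) _.
  by move=> e e0; apply: (@scalar_cvg_lin _ U a _ _ _ _ _ (zP f) (zP g) e e0).
- by move=> phi; exact: scalar_cvg_norm_le (zP phi) (bd phi).
by exists zz => phi; rewrite zzE; exact: zP.
Qed.

End functionals.

(** * Weak compactness from uniform convexity *)

Section weak_compactness.
Context {R : realType} {k : scalars}.
Local Notation K := (scalarField R k).
Variable X : normedModType K.

Definition midpoint (x y : X) : X := sreal k 2^-1 *: (x + y).

Definition midconvex (W : set X) := forall x y, W x -> W y -> W (midpoint x y).

Lemma midconvex_preball (phi : dual X) (l : K) (e : R) :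
  midconvex [set x | rnorm (phi x - l) < e].
Proof.
move=> x y /= xe ye.
have h : (sreal k 2^-1 + sreal k 2^-1 : K) = 1.
  by rewrite -srealD -[2^-1]mul1r -splitr sreal1.
have -> : phi (midpoint x y) - l = sreal k 2^-1 * ((phi x - l) + (phi y - l)).
  rewrite /midpoint linearZ/= linearD/= -[LHS]/(sreal k 2^-1 * (phi x + phi y) - l).
  by rewrite -{1}(mul1r l) -{1}h; ring.
rewrite srnormM rnorm_sreal ger0_norm ?invr_ge0// mulrC ltr_pdivrMr//.
by rewrite (le_lt_trans (rnormD _ _))// mulr2n mulrDr mulr1 ltrD.
Qed.

Lemma midconvexI (V W : set X) : midconvex V -> midconvex W -> midconvex (V `&` W).
Proof. by move=> cV cW x y [Vx Wx] [Vy Wy]; split; [exact: cV|exact: cW]. Qed.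

(** A form of the Milman-Pettis theorem relative to a convex set: instead of the
    norm, it is some function [q] that is uniformly convex with respect to the
    norm. Let [F] be an ultrafilter on [C], and [al] the supremum of
    the infima of [q] over the midpoint-convex subsets of [C] that belong to [F]. If [V] nearly attains
    [al], the points of [V] where [q] is close to [al] form a slice of small
    diameter, because their midpoints stay in [V] where [q] is nearly at least
    [al]. Such slices need not belong to [F], but they meet every convex member of
    [F], in particular the preimages of small balls around the limits of
    functionals. Hence points chosen in finer and finer slices form a Cauchy
    sequence, and its limit is the weak limit of [F]. *)
Lemma uniformly_convex_weakly_compact (C : set X) (q : X -> R) (M B c : R) :
  midconvex C ->
  (forall x, C x -> rnorm x <= M) ->
  (forall x, C x -> 0 <= q x <= B) ->
  0 <= c ->
  (forall x y, C x -> C y ->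
     rnorm (x - y) ^+ 2 <= c * ((q x + q y) / 2 - q (midpoint x y))) ->
  (forall u : nat -> X, (forall n, C (u n)) ->
     (forall n, rnorm (u n - u n.+1) <= 2^-1 ^+ n) ->
     exists2 x, C x & forall e : R, 0 < e -> \forall n \near \oo, rnorm (u n - x) < e) ->
  weakly_compact C.
Proof.
move=> midC bdC qB c0 ucC complC.
rewrite /weakly_compact compact_ultra => F UF FC.
have Fne V : F V -> V !=set0 by apply: filter_ex.
pose S := [set inf (q @` V) | V in [set V | [/\ F V, midconvex V & V `<=` C]]].
have qlb V : V `<=` C -> has_lbound (q @` V).
  by move=> VC; exists 0 => _ [x Vx <-]; have /andP[] := qB _ (VC _ Vx).
have supS : has_sup S.
  split; first by exists (inf (q @` C)), C => //; split=> //; exact: subset_refl.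
  exists B => _ [V [FV mV VC] <-]; have [x Vx] := Fne _ FV.
  apply: (@le_trans _ _ (q x)); last by have /andP[] := qB _ (VC _ Vx).
  by apply: inf_lbound; [exact: qlb|exists x].
pose al := sup S.
(* with this tolerance the slice [sl n] has diameter at most [2 ^ - n] *)
pose de n : R := 2^-1 ^+ n ^+ 2 / (2 * (c + 1)).
have c1 : 0 < c + 1 by rewrite ltr_wpDl.
have de0 n : 0 < de n by rewrite divr_gt0 ?exprn_gt0 ?mulr_gt0 ?invr_gt0.
have /choice[V VP] n : exists V, [/\ F V, midconvex V, V `<=` C &
    forall x, V x -> al - de n < q x].
  have [_ [V [FV mV VC] <-] lt] := sup_adherent (de0 n) supS.
  exists V; split=> // x Vx; rewrite (lt_le_trans lt)//.
  by apply: inf_lbound; [exact: qlb|exists x].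
pose sl n := [set x | V n x /\ q x < al + de n].
have slmeet n W : F W -> midconvex W -> (W `&` sl n) !=set0.
  move=> FW mW; have [FV mV VC _] := VP n.
  have FI : F (V n `&` W) by exact: filterI.
  have hinf : has_inf (q @` (V n `&` W)).
    split; first by have [x ?] := Fne _ FI; exists (q x), x.
    by apply: qlb => x [/VC].
  have [_ [x [Vx Wx] <-] qx] := inf_adherent (de0 n) hinf.
  exists x; split => //; split=> //; rewrite (lt_le_trans qx)// lerD2r.
  apply: sup_upper_bound => //; exists (V n `&` W) => //; split => //.
    exact: midconvexI.
  by move=> y [/VC].
have slsmall n x y : sl n x -> sl n y -> rnorm (x - y) <= 2^-1 ^+ n.
  move=> [Vx qx] [Vy qy]; have [_ mV VC qV] := VP n.
  rewrite -(@ler_pXn2r _ 2)// ?nnegrE ?rnorm_ge0 ?exprn_ge0 ?invr_ge0//.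
  rewrite (le_trans (ucC _ _ (VC _ Vx) (VC _ Vy)))//.
  have qm := qV _ (mV _ _ Vx Vy).
  apply: (@le_trans _ _ ((c + 1) * (2 * de n))).
    apply: (@le_trans _ _ (c * (2 * de n))).
      by apply: ler_wpM2l => //; move: qm qx qy; set m := q (midpoint x y); lra.
    by apply: ler_wpM2r; [rewrite mulr_ge0// ltW|rewrite lerDl].
  by rewrite mulrA [(c + 1) * 2]mulrC /de mulrCA mulfV ?mulr1// gt_eqF// mulr_gt0.
have deS n : de n.+1 <= de n.
  rewrite /de ler_wpM2r ?invr_ge0 ?mulr_ge0 ?(ltW c1)//.
  rewrite lerXn2r ?nnegrE ?exprn_ge0 ?invr_ge0// exprS ler_piMl ?exprn_ge0 ?invr_ge0//.
  by rewrite invf_le1 ?ler1n.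
(* [u n.+1] is asked to lie in [V n] as well, so that [u n] and [u n.+1] are in the
   same slice *)
have /choice[u uP] n : exists x, V n.-1 x /\ sl n x.
  have [FV mV _ _] := VP n.-1.
  by have [x [Vx slx]] := slmeet n _ FV mV; exists x.
have Cu n : C (u n) by have [_ [Vu _]] := uP n; have [_ _ VC _] := VP n; exact: VC.
have uS n : rnorm (u n - u n.+1) <= 2^-1 ^+ n.
  apply: slsmall; first by have [] := uP n.
  have [Vu [_ qu]] := uP n.+1; split => //.
  by rewrite (lt_le_trans qu)// lerD2l.
have [x Cx ux] := complC u Cu uS.
exists x; split => //.
apply/weak_cvgP => phi e e0.
have [l lP] : exists l : K, forall e : R, 0 < e -> F [set y | rnorm (phi y - l) < e].
  apply: (@scalar_ultra_cvg _ _ _ _ _ (dual_norm phi * M)).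
  apply: filterS FC => y /bdC yM /=.
  by rewrite (le_trans (dual_normP _ _))// ler_wpM2l ?dual_norm_ge0.
suff -> : phi x = l by exact: lP.
apply/subr0_eq/rnorm_eq0/eqP; rewrite eq_le rnorm_ge0 andbT.
apply/ler_addgt0Pr => {}e {}e0; rewrite add0r.
have p1 : 0 < dual_norm phi + 1 by rewrite ltr_wpDl// dual_norm_ge0.
pose r := e / 3 / (dual_norm phi + 1).
have r0 : 0 < r by rewrite !divr_gt0.
have phir y : rnorm y <= r -> rnorm (phi y) <= e / 3.
  move=> yr; rewrite (le_trans (dual_normP _ _))//.
  rewrite (@le_trans _ _ ((dual_norm phi + 1) * r))//; last first.
    by rewrite /r mulrC divfK// gt_eqF.
  by rewrite ler_pM ?dual_norm_ge0 ?rnorm_ge0// lerDl.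
have half0 : (2^-1 : R) ^+ n @[n --> \oo] --> 0.
  by apply: cvg_expr; rewrite ger0_norm ?invr_ge0// invf_lt1 ?ltr1n.
have [n [un nr]] : exists n, rnorm (u n - x) < r /\ 2^-1 ^+ n <= r.
  move/cvgr0Pnorm_le : half0 => /(_ _ r0) hr.
  have := filter_meets _ (ux _ r0) hr.
  by case=> // n [/= h1 h2]; exists n; split=> //; rewrite (le_trans (ler_norm _)).
have e3 : 0 < e / 3 by rewrite divr_gt0.
have [y [yl sly]] := slmeet n _ (lP _ e3)
  (midconvex_preball (phi := phi) (l := l) (e := e / 3)).
have -> : phi x - l = (phi (x - u n) + phi (u n - y)) + (phi y - l).
  by rewrite !dualB; ring.
have h1 := phir (x - u n); have h2 := phir (u n - y).
rewrite (le_trans (rnormD _ _))// (_ : e = e / 3 + e / 3 + e / 3); last by field.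
rewrite lerD ?(ltW yl)// (le_trans (rnormD _ _))// lerD//.
  by apply: h1; rewrite rnormBC ltW.
apply: h2; rewrite (le_trans _ nr)//; apply: slsmall => //.
by have [] := uP n.
Qed.

End weak_compactness.

(** * The inequalities valid in every normed space *)

Section general_inequalities.
Context {R : realType} {k : scalars}.
Local Notation K := (scalarField R k).

Section dist.
Variable V : normedModType K.
Implicit Types A B : set V.

Lemma setdist_le A B a b : A a -> B b -> (setdist A B <= (rnorm (a - b))%:E)%E.
Proof. by move=> Aa Bb; apply: ereal_inf_lbound; exists a => //; exists b. Qed.

Lemma setdist_ge A B (x : \bar R) :
  (forall a b, A a -> B b -> x <= (rnorm (a - b))%:E)%E -> (x <= setdist A B)%E.
Proof. by move=> h; apply: le_ereal_inf_tmp => _ [a Aa [b Bb <-]]; exact: h. Qed.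

Lemma setdist_ge0 A B : (0 <= setdist A B)%E.
Proof. by apply: setdist_ge => a b _ _; rewrite lee_fin rnorm_ge0. Qed.

Lemma setdist_lt A B (x : \bar R) : (setdist A B < x)%E ->
  exists a b, [/\ A a, B b & ((rnorm (a - b))%:E < x)%E].
Proof. by move=> /ereal_inf_lt[_ [a Aa [b Bb <-]] h]; exists a, b. Qed.

Lemma setdistS A A' B : A `<=` A' -> (setdist A' B <= setdist A B)%E.
Proof. by move=> AA'; apply: setdist_ge => a b /AA' Aa Bb; exact: setdist_le. Qed.

Lemma hatdist_le A B (x : \bar R) :
  (forall a, A a -> setdist [set a] B <= x)%E -> (hatdist A B <= x)%E.
Proof. by move=> h; apply: ge_ereal_sup => _ [a Aa <-]; exact: h. Qed.

Lemma hatdist_ge A B a : A a -> (setdist [set a] B <= hatdist A B)%E.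
Proof. by move=> Aa; apply: ereal_sup_ubound; exists a. Qed.

End dist.

Variable X : normedModType K.
Implicit Types A : set X.
Local Notation emb := (@bidual_emb R k X).

Lemma bounded_rnorm A : bounded_set A -> exists M : R, forall x, A x -> rnorm x <= M.
Proof.
case=> M [Mr MA]; exists (sre k (`|M| + 1)) => x Ax.
apply: ler_sre; apply: MA Ax.
by rewrite (le_lt_trans (real_ler_norm Mr))// ltrDl.
Qed.

Lemma clust_frequently (x : nat -> X) (z : dual (dual X)) (phi : dual X)
    (e : R) (N : nat) :
  clust x z -> 0 < e -> exists2 n, (N <= n)%N & rnorm (z phi - phi (x n)) < e.
Proof.
move=> xz e0.
have /(_ _ e0) zB : forall e : R, 0 < e ->
    @nbhs _ (weakstar (dual X)) (z : weakstar _)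
      [set w : dual (dual X) | rnorm (w phi - z phi) < e].
  move=> r r0; have := @weak_cvgP R k (dual (dual X)) (dual X)
    (fun f : dual (dual X) => (f : dual X -> K^o))
    (@nbhs _ (weakstar (dual X)) (z : weakstar _)) z _.
  by case=> + _; apply.
have xN : (bidual_emb (x n) @[n --> \oo]) [set w | exists2 n, (N <= n)%N & w = emb (x n)].
  by exists N => // n /= Nn; exists n.
have [w [[n Nn ->] /= h]] := xz _ _ xN zB.
by exists n => //; rewrite rnormBC.
Qed.

Lemma clust_neq0 (x : nat -> X) (M : R) :
  (forall n, rnorm (x n) <= M) -> clust x !=set0.
Proof.
move=> xM; have [U [UU ooU]] := ultraFilterLemma (eventually_filter : ProperFilter \oo).
have [|z zP] := @ultra_dual_cvg R k X _ _ x M UU.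
  by apply: filterS filterT => n _ /=.
exists z => P Q xP zQ.
have cv : (fun n => emb (x n)) @ U --> (z : weakstar (dual X)).
  by apply/weak_cvgP => phi e e0; exact: zP.
have /filter_ex[n [Pn Qn]] : U ((fun n => emb (x n)) @^-1` (P `&` Q)).
  by rewrite preimage_setI; apply: filterI; [exact: ooU|exact: cv].
by exists (emb (x n)).
Qed.

(** Together with [clust_neq0] this gives [wck A <= wk A]; nonemptiness matters, as
    the distance from the empty set is infinite. *)
Lemma clust_closure A (x : nat -> X) : (forall n, A (x n)) ->
  clust x `<=` weakstar_closure (emb @` A).
Proof.
move=> xA z xz B zB.
have xA' : (bidual_emb (x n) @[n --> \oo]) (emb @` A).
  by exists 0%N => // n _; exists (x n).
exact: xz xA' zB.
Qed.

Lemma wck_le_wk A : bounded_set A -> (wck A <= wk A)%E.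
Proof.
move=> /bounded_rnorm[M AM]; apply: ge_ereal_sup => _ [x xA <-].
have [z xz] : clust x !=set0 by apply: (@clust_neq0 _ M) => n; exact/AM.
apply: (@le_trans _ _ (setdist [set z] (range emb))).
  by apply: setdistS => _ ->.
by apply: hatdist_ge; exact: clust_closure xz.
Qed.

(** If [C] is weakly compact and every point of [A] is within [h + e] of [C], a
    weak* limit [z] of points of [A] along an ultrafilter is within [h + e] of the
    weak limit of the nearby points of [C]: the norm is weak* lower
    semicontinuous. *)
Lemma wk_le_omega A : (wk A <= omega A)%E.
Proof.
apply: le_ereal_inf_tmp => _ [C [C0 wC] <-]; apply: hatdist_le => z.
rewrite /weakstar_closure closureEcvg => -[G PG [Gz GA]].
have {GA}GA : G (emb @` A) by apply: GA.
have [_ [a Aa _]] := filter_ex GA.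
have : (0 <= hatdist A C)%E by apply: le_trans (hatdist_ge C Aa); exact: setdist_ge0.
case E : (hatdist A C) => [h| |] //; rewrite ?leey// lee_fin => h0.
apply/lee_addgt0Pr => e e0; rewrite -EFinD.
have [U [UU GU]] := ultraFilterLemma PG.
have /choice[p pP] (w : dual (dual X)) : exists x : X, (emb @` A) w ->
    C x /\ forall phi : dual X, rnorm (w phi - phi x) <= (h + e) * rnorm phi.
  have [[b Ab <-]|nA] := pselect ((emb @` A) w); last by exists 0.
  have : (setdist [set b] C < (h + e)%:E)%E.
    by rewrite (le_lt_trans (hatdist_ge C Ab))// E lte_fin ltrDl.
  move=> /setdist_lt[_ [x [-> Cx bx]]]; exists x => _; split=> // phi.
  rewrite -[X in rnorm X]/(phi b - phi x) -dualB (le_trans (dual_normP _ _))// mulrC.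
  by rewrite -rnorm_dualE ler_wpM2r ?rnorm_ge0// ltW.
have UA : U (emb @` A) by exact: GU.
move: wC; rewrite /weakly_compact compact_ultra => /(_ (p @ U)).
case.
- exact: ultra_fmap.
- by change (U (p @^-1` C)); apply: filterS UA => w /pP[].
move=> x [Cx /= px]; apply: (@le_trans _ _ (rnorm (z - emb x))%:E).
  by apply: setdist_le => //; exists x.
rewrite lee_fin rnorm_dualE; apply: dual_norm_le.
  by rewrite addr_ge0// ltW.
move=> phi; rewrite bidualB.
have pl r : 0 < r -> U [set w | rnorm (phi (p w) - phi x) < r].
  by move=> r0; have /weak_cvgP/(_ phi r r0) := px.
have zl r : 0 < r -> U [set w : dual (dual X) | rnorm (w phi - z phi) < r].
  by move=> r0; apply: GU; have /weak_cvgP/(_ phi r r0) := Gz.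
rewrite (_ : z phi - _ = -1 * phi x + z phi); last by rewrite mulN1r addrC.
apply: (scalar_cvg_norm_le (F := U)); first by move=> r r0; apply: (scalar_cvg_lin (-1) _ pl zl).
by apply: filterS UA => w /pP[_ /(_ phi)] /=; rewrite mulN1r addrC.
Qed.

End general_inequalities.

(** * Integrals of real functions *)

Section real_integrals.
Context {R : realType} d {T : measurableType d}.
Variable mu : {measure set T -> \bar R}.
Implicit Types f g : T -> R.

Lemma measurable_inv : measurable_fun [set: R] (@GRing.inv R).
Proof.
have -> : [set: R] = [set 0] `|` [set~ 0] by rewrite setUv.
apply/measurable_funU; [exact: measurable_set1|by apply: measurableC|split].
  exact: measurable_fun_set1.
apply: open_continuous_measurable_fun; first exact/closed_openC/closed_eq.
by move=> x; rewrite inE => /eqP; exact: inv_continuous.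
Qed.

Lemma measurable_divr f g : measurable_fun setT f -> measurable_fun setT g ->
  measurable_fun setT (fun t => f t / g t).
Proof.
move=> mf mg; apply: measurable_funM => //.
exact: (measurableT_comp measurable_inv).
Qed.

Lemma measurable_leset f g : measurable_fun setT f -> measurable_fun setT g ->
  measurable [set t | f t <= g t].
Proof.
move=> mf mg; have := measurable_fun_ler mf mg measurableT (Y := [set true]) I.
by rewrite setTI.
Qed.

(** Integrals over subsets are written with indicator functions, so a notion for the
    whole space is enough. *)
Definition itg f := mu.-integrable setT (EFin \o f).

Lemma itg_measurable f : itg f -> measurable_fun setT f.
Proof. by move/(measurable_int mu)/measurable_EFinP. Qed.

Lemma itgD f g : itg f -> itg g -> itg (fun t => f t + g t).
Proof. by move=> fi gi; apply: (integrableD measurableT fi gi). Qed.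

Lemma itgB f g : itg f -> itg g -> itg (fun t => f t - g t).
Proof. by move=> fi gi; apply: (integrableB measurableT fi gi). Qed.

Lemma itgZ (a : R) f : itg f -> itg (fun t => a * f t).
Proof. by move=> fi; apply: (integrableZl measurableT a fi). Qed.

Lemma itg0 : itg (fun _ => 0).
Proof. exact: integrable0. Qed.

Lemma itg_dom f g : measurable_fun setT f -> (forall t, `|f t| <= g t) ->
  itg g -> itg f.
Proof.
move=> mf fg; apply: le_integrable => //; first exact/measurable_EFinP.
move=> t _; rewrite /= lee_fin (le_trans (fg t))//; exact: ler_norm.
Qed.

Lemma itg_max f g : itg f -> itg g -> itg (fun t => Num.max (f t) (g t)).
Proof.
move=> fi gi; apply: (@itg_dom _ (fun t => `|f t| + `|g t|)).
- by apply: measurable_maxr; exact: itg_measurable.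
- by move=> t; rewrite /Num.max; case: ifP => _; rewrite ?lerDl ?lerDr.
- by apply: itgD; exact: integrable_norm.
Qed.

Lemma itgM_indic f E : measurable E -> itg f -> itg (fun t => f t * \1_E t).
Proof.
move=> mE fi; apply: (@itg_dom _ (fun t => `|f t|)).
- apply: measurable_funM; [exact: itg_measurable|exact: measurable_indic].
- move=> t; rewrite normrM indicE.
  by case: (_ \in _); rewrite ?normr1 ?mulr1// normr0 mulr0.
- exact: integrable_norm.
Qed.

Lemma intD f g : itg f -> itg g -> \int[mu]_t (f t + g t) = \int[mu]_t f t + \int[mu]_t g t.
Proof. exact: RintegralD. Qed.

Lemma intB f g : itg f -> itg g -> \int[mu]_t (f t - g t) = \int[mu]_t f t - \int[mu]_t g t.
Proof. exact: RintegralB. Qed.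

Lemma intZ (a : R) f : itg f -> \int[mu]_t (a * f t) = a * \int[mu]_t f t.
Proof. exact: RintegralZl. Qed.

Lemma int_ge0 f : (forall t, 0 <= f t) -> 0 <= \int[mu]_t f t.
Proof. by move=> f0; apply: Rintegral_ge0. Qed.

Lemma int_le f g : itg f -> itg g -> (forall t, f t <= g t) -> \int[mu]_t f t <= \int[mu]_t g t.
Proof. by move=> fi gi fg; apply: le_Rintegral => // t _; exact: fg. Qed.

Lemma int_norm_le f : itg f -> `|\int[mu]_t f t| <= \int[mu]_t `|f t|.
Proof. by move=> fi; apply: le_normr_Rintegral. Qed.

Lemma int_ae_eq f g : measurable_fun setT f -> measurable_fun setT g ->
  {ae mu, forall t, f t = g t} -> \int[mu]_t f t = \int[mu]_t g t.
Proof.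
move=> mf mg fg; congr fine; apply: ae_eq_integral => //.
- exact/measurable_EFinP.
- exact/measurable_EFinP.
- by apply: filterS fg => t /= -> _.
Qed.

Lemma int_ae_le f g : itg f -> itg g -> {ae mu, forall t, f t <= g t} ->
  \int[mu]_t f t <= \int[mu]_t g t.
Proof.
move=> fi gi fg; have mi := itg_max fi gi.
rewrite -(@int_ae_eq (fun t => Num.max (f t) (g t)) g).
- by apply: int_le => // t; rewrite le_max lexx.
- exact: itg_measurable.
- exact: itg_measurable.
- by apply: filterS fg => t /= /max_idPr.
Qed.

Lemma int_EFin f : itg f -> (\int[mu]_t (f t)%:E = (\int[mu]_t f t)%:E)%E.
Proof. by move=> fi; rewrite fineK//; exact: integrable_fin_num. Qed.

End real_integrals.

(** * Elements and functionals of L1 *)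

Section L1_elements.
Context {R : realType} {k : scalars} d {T : measurableType d}.
Local Notation K := (scalarField R k).
Variable mu : {measure set T -> \bar R}.
Implicit Types (f g : L1 k mu) (F H : T -> K).

Lemma L1_valD f g : {ae mu, forall t, (f + g : L1 k mu) t = f t + g t}.
Proof.
have -> : f + g = \pi_(L1 k mu)%qT (L1_repr f + L1_repr g) by rewrite -L1_piD !reprK.
by apply: filterS (L1_piK (L1_repr f + L1_repr g)) => t /(_ I).
Qed.

Lemma L1_valZ (a : K) f : {ae mu, forall t, (a *: f : L1 k mu) t = a * f t}.
Proof.
have -> : a *: f = \pi_(L1 k mu)%qT (a *: L1_repr f) by rewrite -L1_piZ !reprK.
by apply: filterS (L1_piK (a *: L1_repr f)) => t /(_ I).
Qed.

Lemma L1_valB f g : {ae mu, forall t, (f - g : L1 k mu) t = f t - g t}.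
Proof.
rewrite -scaleN1r; apply: filterS2 (L1_valD f (-1 *: g)) (L1_valZ (-1) g) => t -> ->.
by rewrite mulN1r.
Qed.

Definition smeasurable F :=
  measurable_fun setT (fun t => sre k (F t)) /\
  measurable_fun setT (fun t => sim k (F t)).

Lemma smeasurable_rnorm F : smeasurable F -> measurable_fun setT (fun t => rnorm (F t)).
Proof.
move=> [mr mi]; under eq_fun do rewrite snormE.
apply: (measurableT_comp (continuous_measurable_fun (@sqrt_continuous R))).
by apply: measurable_funD; exact: measurable_funX.
Qed.

Lemma smeasurableM F H : smeasurable F -> smeasurable H ->
  smeasurable (fun t => F t * H t).
Proof.
move=> [Fr Fi] [Hr Hi]; split.
- under eq_fun do rewrite sreM.
  by apply: measurable_funB; exact: measurable_funM.
- under eq_fun do rewrite simM.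
  by apply: measurable_funD; exact: measurable_funM.
Qed.

Lemma smeasurableB F H : smeasurable F -> smeasurable H ->
  smeasurable (fun t => F t - H t).
Proof.
move=> [Fr Fi] [Hr Hi]; split.
- by under eq_fun do rewrite sreD sreN; exact: measurable_funB.
- by under eq_fun do rewrite simD simN; exact: measurable_funB.
Qed.

Lemma smeasurableD F H : smeasurable F -> smeasurable H ->
  smeasurable (fun t => F t + H t).
Proof.
move=> [Fr Fi] [Hr Hi]; split.
- by under eq_fun do rewrite sreD; exact: measurable_funD.
- by under eq_fun do rewrite simD; exact: measurable_funD.
Qed.

Lemma smeasurable_sreal (u : T -> R) : measurable_fun setT u ->
  smeasurable (fun t => sreal k (u t)).
Proof.
move=> mu'; split; first by under eq_fun do rewrite sre_sreal.
by under eq_fun do rewrite sim_sreal; exact: measurable_cst.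
Qed.

Lemma smeasurable_L1 f : smeasurable f.
Proof.
have /L1fun_predP[rf jf] := valP (L1_repr f).
by split; apply/measurable_EFinP; [exact: measurable_int rf|exact: measurable_int jf].
Qed.

Lemma smeasurable_sscal (a b : T -> R) : measurable_fun setT a -> measurable_fun setT b ->
  smeasurable (fun t => sscal (a t) (b t)).
Proof.
move=> ma mb; split; first by under eq_fun do rewrite sre_sscal.
by rewrite /sscal; case: (k) => //=; exact: measurable_cst.
Qed.

Lemma smeasurable_sphase F : smeasurable F -> smeasurable (fun t => sphase (F t)).
Proof.
move=> mF; have [mr mi] := mF; have mn := smeasurable_rnorm mF.
under eq_fun do rewrite sphaseE.
apply: smeasurable_sscal; first exact: measurable_divr.
by apply: measurable_funN; exact: measurable_divr.
Qed.

Lemma itg_parts F (g : T -> R) : smeasurable F -> (forall t, rnorm (F t) <= g t) ->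
  itg mu g -> itg mu (fun t => sre k (F t)) /\ itg mu (fun t => sim k (F t)).
Proof.
move=> [mr mi] Fg gi; split; apply: itg_dom gi => // t; apply: le_trans (Fg t).
  exact: sre_le_rnorm.
exact: sim_le_rnorm.
Qed.

Lemma L1_of_dominated F (g : T -> R) : smeasurable F -> (forall t, rnorm (F t) <= g t) ->
  itg mu g -> exists f, {ae mu, forall t, f t = F t}.
Proof.
move=> mF Fg gi.
have FP : (F : T -> K^o) \in L1fun_pred mu.
  by apply/L1fun_predP; exact: (itg_parts mF Fg gi).
exists (\pi_(L1 k mu)%qT (MkL1fun FP)).
by apply: filterS (L1_piK (MkL1fun FP)) => t /(_ I).
Qed.

Lemma itg_L1 f : itg mu (fun t => rnorm (f t)).
Proof. exact: L1fun_integrable. Qed.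

Lemma rnorm_L1E f : rnorm f = \int[mu]_t rnorm (f t).
Proof. exact: srealK. Qed.

(** The bound on the norm follows from the bound for real parts
    after rotating [f] by a unimodular scalar. *)
Lemma L1_pairing (h : T -> K) : smeasurable h -> (forall t, rnorm (h t) <= 1) ->
  exists2 phi : dual (L1 k mu), dual_norm phi <= 1 &
    forall f, sre k (phi f) = \int[mu]_t sre k (f t * h t).
Proof.
move=> mh h1.
pose p f := sscal (\int[mu]_t sre k (f t * h t)) (\int[mu]_t sim k (f t * h t)) : K.
have ip f : itg mu (fun t => sre k (f t * h t)) /\ itg mu (fun t => sim k (f t * h t)).
  apply: itg_parts (itg_L1 f); first exact/smeasurableM/mh/smeasurable_L1.
  by move=> t; rewrite srnormM ler_piMr ?rnorm_ge0.
have sim_p f : sim k (p f) = \int[mu]_t sim k (f t * h t).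
  rewrite /p /sscal; move: (k) f h {mh h1 p ip} => [|//] f h /=.
  by rewrite /Rintegral integral0.
have lp a f g : p (a *: f + g) = a * p f + p g.
  have E : {ae mu, forall t,
      (a *: f + g : L1 k mu) t * h t = a * (f t * h t) + g t * h t}.
    apply: filterS2 (L1_valD (a *: f) g) (L1_valZ a f) => t -> ->.
    by rewrite mulrDl mulrA.
  have [i1 i2] := ip f; have [j1 j2] := ip g; have [l1 l2] := ip (a *: f + g).
  apply: scalarP.
  - rewrite sreD sreM !sim_p !sre_sscal.
    rewrite -!intZ// -intB; [|exact: itgZ..].
    rewrite -intD//; last by apply: itgB; exact: itgZ.
    apply: int_ae_eq; first exact: itg_measurable l1.
      exact: itg_measurable (itgD (itgB (itgZ _ i1) (itgZ _ i2)) j1).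
    by apply: filterS E => t ->; rewrite sreD (sreM a).
  - rewrite simD simM !sim_p !sre_sscal.
    rewrite -!intZ// -intD; [|exact: itgZ..].
    rewrite -intD//; last by apply: itgD; exact: itgZ.
    apply: int_ae_eq; first exact: itg_measurable l2.
      exact: itg_measurable (itgD (itgD (itgZ _ i2) (itgZ _ i1)) j2).
    by apply: filterS E => t ->; rewrite simD (simM a).
have re_p f : sre k (p f) <= rnorm f.
  rewrite sre_sscal rnorm_L1E; apply: int_le (ip f).1 (itg_L1 f) _ => t.
  rewrite (le_trans (ler_norm _))// (le_trans (sre_le_rnorm _))//.
  by rewrite srnormM ler_piMr ?rnorm_ge0.
have bp f : rnorm (p f) <= 1 * rnorm f.
  have p0 : p 0 = 0.
    have := lp 1 0 0; rewrite scaler0 addr0 mul1r => /esym.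
    by rewrite -{3}[p 0]add0r => /addIr.
  have pu : p (sphase (p f) *: f) = sreal k (rnorm (p f)).
    by have := lp (sphase (p f)) f 0; rewrite !addr0 p0 addr0 sphaseM.
  rewrite mul1r -(sre_sreal (k := k) (rnorm (p f))) -pu (le_trans (re_p _))//.
  by rewrite rnormZ ler_piMl ?rnorm_ge0// rnorm_sphase.
have [phi phiE ph1] := bounded_linear_dual lp bp.
exists phi; first exact: ph1.
by move=> f; rewrite phiE sre_sscal.
Qed.

End L1_elements.

(** * Weak compactness of order intervals *)

Section series.
Context {R : realType}.

Lemma sum_half (n : nat) : \sum_(0 <= i < n) (2^-1 : R) ^+ i <= 2.
Proof.
have -> : \sum_(0 <= i < n) (2^-1 : R) ^+ i = 2 - 2 * 2^-1 ^+ n.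
  elim: n => [|n IH]; first by rewrite big_nil expr0 mulr1 subrr.
  by rewrite big_nat_recr//= IH exprS; field.
by rewrite lerBlDr lerDl mulr_ge0// exprn_ge0// invr_ge0.
Qed.

Lemma nneseries_le (a : nat -> R) (B : R) : (forall n, 0 <= a n) ->
  (forall n, \sum_(0 <= i < n) a i <= B) -> (\sum_(n <oo) (a n)%:E <= B%:E)%E.
Proof.
move=> a0 aB; apply: lime_le; first by apply: is_cvg_nneseries => n _ _; rewrite lee_fin.
by apply: nearW => n; rewrite sumEFin lee_fin.
Qed.

Lemma summable_increments_cvg (u v : nat -> R) :
  (forall n, `|u n.+1 - u n| <= v n) -> (\sum_(n <oo) (v n)%:E < +oo)%E -> cvgn u.
Proof.
move=> uv voo.
have v0 n : 0 <= v n by apply: le_trans (uv n).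
have cv : cvgn (series v).
  apply: nondecreasing_is_cvgn; first exact: nondecreasing_series.
  exists (fine (\sum_(n <oo) (v n)%:E)) => _ [n _ <-].
  rewrite -lee_fin fineK; last first.
    by rewrite ge0_fin_numE// nneseries_ge0// => i _ _; rewrite lee_fin.
  rewrite /series/= -sumEFin; apply: nneseries_lim_ge => i _ _.
  by rewrite lee_fin.
have ct : cvgn (series (telescope u)).
  apply: normed_cvg; apply: series_le_cvg cv => // n; first exact: normr_ge0.
have -> : u = (fun n => u 0%N + series (telescope u) n).
  by apply/funext => n; exact: eq_sum_telescope.
by apply: is_cvgD => //; exact: is_cvg_cst.
Qed.

End series.

Section scalar_convexity.
Context {R : realType} {k : scalars}.
Local Notation K := (scalarField R k).

Lemma parallelogram (a b : K) : rnorm (a - b) ^+ 2 =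
  2 * rnorm a ^+ 2 + 2 * rnorm b ^+ 2 - 4 * rnorm (sreal k 2^-1 * (a + b)) ^+ 2.
Proof.
rewrite !rnorm_sqr !(sreD, simD, sreM, simM, sreN, simN, sre_sreal, sim_sreal).
by field.
Qed.

(** From [n <= n ^ 2 / (2 s G) + s G / 2], an instance of the arithmetic-geometric mean
    inequality; integrated, it replaces the Cauchy-Schwarz inequality. *)
Lemma uniform_convexity_ptwise (a b : K) (G s : R) : 0 < s ->
  rnorm a <= G -> rnorm b <= G ->
  rnorm (a - b) <= (2 * s)^-1 * (2 * (rnorm a ^+ 2 / G) + 2 * (rnorm b ^+ 2 / G)
     - 4 * (rnorm (sreal k 2^-1 * (a + b)) ^+ 2 / G)) + s / 2 * G.
Proof.
move=> s0 aG bG; have G0 : 0 <= G by apply: le_trans aG; exact: rnorm_ge0.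
have -> : 2 * (rnorm a ^+ 2 / G) + 2 * (rnorm b ^+ 2 / G)
     - 4 * (rnorm (sreal k 2^-1 * (a + b)) ^+ 2 / G) = rnorm (a - b) ^+ 2 / G.
  by rewrite parallelogram; ring.
move: G0; rewrite le_eqVlt => /predU1P[G0|G0].
  move: aG bG; rewrite -G0 => aG bG.
  by rewrite invr0 !mulr0 addr0 (le_trans (rnormB _ _))// -[leRHS]addr0 lerD.
set n := rnorm (a - b).
rewrite -subr_ge0.
have -> : (2 * s)^-1 * (n ^+ 2 / G) + s / 2 * G - n = (n - s * G) ^+ 2 / (2 * s * G).
  by field; rewrite !gt_eqF.
by rewrite divr_ge0 ?sqr_ge0// !mulr_ge0// ltW.
Qed.

End scalar_convexity.

Section order_interval.
Context {R : realType} {k : scalars} d {T : measurableType d}.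
Local Notation K := (scalarField R k).
Variable mu : {measure set T -> \bar R}.
Variable g : T -> R.
Hypotheses (g0 : forall t, 0 <= g t) (gi : itg mu g).
Implicit Types (f : L1 k mu).

Definition order_interval : set (L1 k mu) :=
  [set f | {ae mu, forall t, rnorm (f t) <= g t}].

Local Notation C := order_interval.
Local Notation G := (\int[mu]_t g t).

(** On the order interval this is [|f|^2 / g]; the minimum makes it integrable
    for every [f]. *)
Let w f t : R := Num.min (rnorm (f t) ^+ 2) (g t ^+ 2) / g t.

Let w_ge0 f t : 0 <= w f t.
Proof. by rewrite /w divr_ge0// le_min !sqr_ge0. Qed.

Let w_le f t : w f t <= g t.
Proof.
rewrite /w; have := g0 t; rewrite le_eqVlt => /predU1P[<-|gt0].
  by rewrite invr0 mulr0.
by rewrite ler_pdivrMr// -expr2 ge_min lexx orbT.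
Qed.

Let w_itg f : itg mu (w f).
Proof.
apply: itg_dom gi; last by move=> t; rewrite ger0_norm ?w_ge0 ?w_le.
have mg := itg_measurable gi.
apply: measurable_divr => //; apply: measurable_minr; apply: measurable_funX => //.
exact/smeasurable_rnorm/smeasurable_L1.
Qed.

Let wE f : C f -> {ae mu, forall t, w f t = rnorm (f t) ^+ 2 / g t}.
Proof.
apply: filterS => t fg; rewrite /w; congr (_ / _); apply/min_idPl.
by rewrite ler_pXn2r ?nnegrE ?rnorm_ge0.
Qed.

Let q f := \int[mu]_t w f t.

Let midpointE f f' :
  {ae mu, forall t, (midpoint f f' : L1 k mu) t = sreal k 2^-1 * (f t + f' t)}.
Proof.
by apply: filterS2 (L1_valZ (sreal k 2^-1) (f + f')) (L1_valD f f') => t -> ->.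
Qed.

Let midC : midconvex C.
Proof.
move=> f f' Cf Cf'; rewrite /order_interval/=.
apply: filterS2 (midpointE f f') (filterI Cf Cf') => t -> [h1 h2].
rewrite srnormM rnorm_sreal ger0_norm ?invr_ge0// mulrC ler_pdivrMr//.
by rewrite (le_trans (rnormD _ _))// mulr2n mulrDr mulr1 lerD.
Qed.

Let gap_bound f f' (s : R) : C f -> C f' -> 0 < s ->
  rnorm (f - f') <= (2 * s)^-1 * (4 * ((q f + q f') / 2 - q (midpoint f f'))) + s / 2 * G.
Proof.
move=> Cf Cf' s0; have Cm := midC Cf Cf'.
pose m := midpoint f f'.
have i1 : itg mu (fun t => 2 * w f t + 2 * w f' t) by apply: itgD; exact: itgZ.
have i2 : itg mu (fun t => 2 * w f t + 2 * w f' t - 4 * w m t).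
  by apply: itgB => //; exact: itgZ.
have i3 := itgZ (2 * s)^-1 i2.
have i4 := itgZ (s / 2) gi.
have -> : (2 * s)^-1 * (4 * ((q f + q f') / 2 - q m)) + s / 2 * G =
  \int[mu]_t ((2 * s)^-1 * (2 * w f t + 2 * w f' t - 4 * w m t) + s / 2 * g t).
  rewrite intD// !intZ// intB//; last exact: itgZ.
  rewrite intD//; [|exact: itgZ..].
  by rewrite !intZ// /q; field; rewrite gt_eqF.
rewrite rnorm_L1E; apply: int_ae_le; [exact: itg_L1|exact: itgD|].
apply: filterS2 (filterI (L1_valB f f') (midpointE f f'))
  (filterI (filterI Cf Cf') (filterI (wE Cf) (filterI (wE Cf') (wE Cm)))).
move=> t [/= -> mE] [[h1 h2] [-> [-> ->]]].
rewrite mE; exact: uniform_convexity_ptwise.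
Qed.

Let G0 : 0 <= G. Proof. exact: int_ge0. Qed.

Let ucC f f' : C f -> C f' ->
  rnorm (f - f') ^+ 2 <= 4 * (G + 1) * ((q f + q f') / 2 - q (midpoint f f')).
Proof.
move=> Cf Cf'; apply/ler_addgt0Pr => e e0.
pose et := Num.sqrt e.
have et0 : 0 < et by rewrite sqrtr_gt0.
have ete : et ^+ 2 = e by rewrite sqr_sqrtr// ltW.
have G1 : 0 < G + 1 by rewrite ltr_wpDl.
set N := rnorm (f - f'); set D := (q f + q f') / 2 - q _.
have N0 : 0 <= N by exact: rnorm_ge0.
have Ne : 0 < N + et by rewrite ltr_wpDl.
(* [s = N / G] would give [N ^ 2 <= 4 * G * D]; the perturbations avoid dividing
   by 0 *)
have := @gap_bound f f' ((N + et) / (G + 1)) Cf Cf' (divr_gt0 Ne G1).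
rewrite -/N -/D => h.
have {h} : N <= 2 * D * (G + 1) / (N + et) + (N + et) / 2.
  apply: (le_trans h); apply: lerD.
    by rewrite le_eqVlt; apply/orP; left; apply/eqP; field; rewrite !gt_eqF.
  rewrite (_ : _ * G = (N + et) / 2 * (G / (G + 1))); last by field; rewrite gt_eqF.
  rewrite ler_piMr// ?divr_ge0 ?(ltW Ne)//.
  by rewrite ler_pdivrMr// mul1r lerDl.
rewrite -lerBlDr ler_pdivlMr// -ete.
by move: (N) (D) => n x; nra.
Qed.

(** The sequence converges pointwise almost everywhere since its increments are
    summable there, and [g] dominates it. *)
Let completeC (u : nat -> L1 k mu) : (forall n, C (u n)) ->
  (forall n, rnorm (u n - u n.+1) <= 2^-1 ^+ n) ->
  exists2 f, C f & forall e : R, 0 < e -> \forall n \near \oo, rnorm (u n - f) < e.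
Proof.
move=> Cu uS.
pose v n t := rnorm (u n t - u n.+1 t).
have vi n : itg mu (v n).
  apply: (itg_dom _ _ (itgD (itg_L1 (u n)) (itg_L1 (u n.+1)))).
    by apply/smeasurable_rnorm/smeasurableB; exact: smeasurable_L1.
  by move=> t; rewrite ger0_norm ?rnorm_ge0// rnormB.
have v0 n t : (0 <= (v n t)%:E)%E by rewrite lee_fin rnorm_ge0.
have mv n : measurable_fun setT (EFin \o v n).
  by apply/measurable_EFinP; exact: itg_measurable (vi n).
have vint n : \int[mu]_t v n t <= 2^-1 ^+ n.
  apply: le_trans (uS n); rewrite rnorm_L1E; apply: int_ae_le (vi n) (itg_L1 _) _.
  by apply: filterS (L1_valB (u n) (u n.+1)) => t ->.
pose V t := (\sum_(n <oo) (v n t)%:E)%E.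
have mV : measurable_fun setT V.
  by apply: (@ge0_emeasurable_sum _ _ _ _ (fun n t => (v n t)%:E) xpredT)
    => n *; [exact: v0|exact: mv].
have Vi : mu.-integrable setT V.
  apply/integrableP; split => //.
  under eq_integral do rewrite gee0_abs ?nneseries_ge0//.
  rewrite integral_nneseries//.
  under eq_eseriesr do rewrite int_EFin//.
  rewrite (@le_lt_trans _ _ 2%:E) ?ltry//; apply: nneseries_le => n.
    by apply: int_ge0 => t; rewrite rnorm_ge0.
  by rewrite (le_trans _ (sum_half n))// ler_sum.
(* off [E] the functions are replaced by 0, so that the limit is defined and
   measurable everywhere *)
pose E := [set t | (V t < +oo)%E] `&` \bigcap_n [set t | rnorm (u n t) <= g t].
have mE : measurable E.
  apply: measurableI.
    by rewrite -[X in measurable X]setTI; exact: emeasurable_fun_infty_o.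
  apply: bigcapT_measurable => n.
  apply: measurable_leset; last exact: itg_measurable gi.
  exact/smeasurable_rnorm/smeasurable_L1.
have Eae : {ae mu, forall t, E t}.
  have un : {ae mu, forall t, forall n, rnorm (u n t) <= g t} by exact: ae_foralln.
  apply: filterS2 (integrable_ae measurableT Vi) un => t /(_ I) Vt ut.
  by split; [rewrite /= -ge0_fin_numE// nneseries_ge0|move=> n _; exact: ut].
have E0 t : ~ E t -> \1_E t = 0 :> R by move=> nE; rewrite indicE memNset.
have E1 t : E t -> \1_E t = 1 :> R by move=> Et; rewrite indicE mem_set.
have cvg_part (p : K -> R) : {morph p : x y / x + y} -> {morph p : x / - x} ->
    (forall x, `|p x| <= rnorm x) ->
    (forall n, measurable_fun setT (fun t => p (u n t))) ->
    exists2 a : T -> R, measurable_fun setT a &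
      forall t, (p (u n t) * \1_E t) @[n --> \oo] --> a t.
  move=> pD pN pn mp.
  have cv t : cvgn (fun n => p (u n t) * \1_E t).
    have [Et|nEt] := pselect (E t); last first.
      rewrite E0//; under eq_fun do rewrite mulr0; exact: is_cvg_cst.
    rewrite E1//; under eq_fun do rewrite mulr1.
    apply: (@summable_increments_cvg _ _ (v ^~ t)); last by have [] := Et.
    by move=> n; rewrite -pN -pD (le_trans (pn _))// rnormBC.
  exists (fun t => limn (fun n => p (u n t) * \1_E t)); last exact: cv.
  apply: (@measurable_fun_cvg _ _ _ _ (fun n t => p (u n t) * \1_E t));
    last by move=> t _; exact: cv.
  by move=> n; apply: measurable_funM => //; exact: measurable_indic.
have [a ma ua] := cvg_part (sre k) (@sreD _ _) (@sreN _ _) (@sre_le_rnorm _ _)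
  (fun n => (smeasurable_L1 (u n)).1).
have [b mb ub] := cvg_part (sim k) (@simD _ _) (@simN _ _) (@sim_le_rnorm _ _)
  (fun n => (smeasurable_L1 (u n)).2).
pose F t : K := sscal (a t) (b t).
have uF t : forall e : R, 0 < e ->
    \forall n \near \oo, rnorm (sreal k (\1_E t) * u n t - F t) < e.
  apply: scalar_cvg_parts => e e0.
    move/cvgrPdist_lt : (ua t) => /(_ _ e0); apply: filterS => n.
    by rewrite /= sreM sre_sreal sim_sreal mul0r subr0 mulrC distrC.
  move/cvgrPdist_lt : (ub t) => /(_ _ e0); apply: filterS => n.
  by rewrite /= simM sre_sreal sim_sreal mul0r addr0 mulrC distrC.
have Fg t : rnorm (F t) <= g t.
  apply: (@scalar_cvg_norm_le _ _ _ \oo _ _ _ _ (uF t)); exists 0%N => // n _ /=.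
  rewrite srnormM rnorm_sreal.
  have [Et|nEt] := pselect (E t); last by rewrite E0// normr0 mul0r.
  by rewrite E1// normr1 mul1r; have [_] := Et; apply.
have [f fF] := L1_of_dominated (smeasurable_sscal ma mb) Fg gi.
exists f; first by apply: filterS fF => t ->; exact: Fg.
have mr n : measurable_fun setT (fun t => rnorm (u n t - f t)).
  by apply/smeasurable_rnorm/smeasurableB; exact: smeasurable_L1.
have := @dominated_convergence _ _ _ mu setT measurableT
  (fun n t => (rnorm (u n t - f t))%:E) (cst 0%E) (fun t => (g t + g t)%:E).
case.
- by move=> n; exact/measurable_EFinP.
- exact: measurable_cst.
- apply: filterS2 fF Eae => t ft Et _.
  apply/fine_cvgP; split; first exact: nearW.
  apply/cvgrPdist_lt => e e0; apply: filterS (uF t _ e0) => n /=.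
  by rewrite E1// sreal1 mul1r ft sub0r normrN ger0_norm ?rnorm_ge0.
- exact: (itgD gi gi).
- apply: filterS2 fF Eae => t ft [_ Et] n _.
  rewrite /= lee_fin ger0_norm ?rnorm_ge0// (le_trans (rnormB _ _))// lerD//.
    exact: Et.
  by rewrite ft; exact: Fg.
move=> _ h _ e e0.
have {}h : (\int[mu]_t rnorm (u n t - f t)) @[n --> \oo] --> (0 : R).
  apply: cvg_trans (fine_cvg h).
  apply: near_eq_cvg; apply: nearW => n /=; congr fine.
  apply: eq_integral => t _; by rewrite /= subr0 ger0_norm ?rnorm_ge0.
move/cvgrPdist_lt : h => /(_ _ e0); apply: filterS => n.
rewrite sub0r normrN ger0_norm ?int_ge0//; last by move=> t; exact: rnorm_ge0.
apply: le_lt_trans; rewrite rnorm_L1E le_eqVlt; apply/orP; left; apply/eqP.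
apply: int_ae_eq => //; first exact/smeasurable_rnorm/smeasurable_L1.
by apply: filterS (L1_valB (u n) f) => t ->.
Qed.

(** The weighted square norm [q] is uniformly convex on the order interval because
    it satisfies the parallelogram law, and controls the norm of [L1] because
    [g] is integrable. This works for every measure, whereas the dual of [L1] is a space of
    bounded functions for some measures only. *)
Lemma order_interval_weakly_compact : weakly_compact C.
Proof.
apply: (@uniformly_convex_weakly_compact _ _ _ C q G G (4 * (G + 1))).
- exact: midC.
- by move=> f Cf; rewrite rnorm_L1E; exact: int_ae_le (itg_L1 f) gi Cf.
- move=> f _; rewrite int_ge0//=; exact: int_le.
- by rewrite mulr_ge0// addr_ge0.
- exact: ucC.
- exact: completeC.
Qed.

Lemma order_interval0 : C 0.
Proof.
have -> : 0 = 0 *: 0 :> L1 k mu by rewrite scaler0.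
apply: filterS (L1_valZ 0 (0 : L1 k mu)) => t ->.
by rewrite mul0r rnorm0.
Qed.

(** Cutting [f] off at height [g] gives the best approximation of [f] in the
    order interval. *)
Lemma setdist_order_interval f :
  (setdist [set f] C <= (\int[mu]_t Num.max (rnorm (f t) - g t) 0)%:E)%E.
Proof.
pose F t : K := sreal k (Num.min 1 (g t / rnorm (f t))) * f t.
have mf := smeasurable_rnorm (smeasurable_L1 f).
have mg := itg_measurable gi.
have mF : smeasurable F.
  apply: smeasurableM; last exact: smeasurable_L1.
  apply: smeasurable_sreal; apply: measurable_minr => //.
  exact: measurable_divr.
have r0 t : 0 <= Num.min 1 (g t / rnorm (f t)).
  by rewrite le_min ler01 divr_ge0 ?rnorm_ge0.
have Fg t : rnorm (F t) <= g t.
  rewrite srnormM rnorm_sreal ger0_norm//.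
  have := rnorm_ge0 (f t); rewrite le_eqVlt => /predU1P[<-|ft0]; first by rewrite mulr0.
  by rewrite -ler_pdivlMr// ge_min lexx orbT.
have [h hF] := L1_of_dominated mF Fg gi.
apply: (@le_trans _ _ (rnorm (f - h))%:E).
  by apply: setdist_le => //; apply: filterS hF => t ->; exact: Fg.
rewrite lee_fin rnorm_L1E; apply: int_ae_le (itg_L1 _) _ _.
  by apply: itg_max; [exact: itgB (itg_L1 f) gi|exact: itg0].
apply: filterS2 (L1_valB f h) hF => t -> ->.
rewrite /F; set r := Num.min _ _.
have -> : f t - sreal k r * f t = sreal k (1 - r) * f t.
  by rewrite -{1}(mul1r (f t)) -mulrBl; congr (_ * _); apply: scalarP;
    rewrite ?(sreD, simD, sreN, simN, sre_sreal, sim_sreal) -?sreal1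
      ?(sre_sreal, sim_sreal) ?subr0.
rewrite srnormM rnorm_sreal ger0_norm; last by rewrite subr_ge0 ge_min lexx.
have := rnorm_ge0 (f t); rewrite le_eqVlt => /predU1P[<-|ft0].
  by rewrite mulr0 le_max lexx orbT.
rewrite /r; have [h1|h1] := leP 1 (g t / rnorm (f t)).
  by rewrite subrr mul0r le_max lexx orbT.
by rewrite mulrBl mul1r divfK ?gt_eqF// le_max lexx.
Qed.

End order_interval.

(** * Gliding humps *)

Section gliding_hump.
Context {R : realType} {k : scalars} d {T : measurableType d}.
Local Notation K := (scalarField R k).
Variable mu : {measure set T -> \bar R}.
Variables (f : nat -> L1 k mu) (E : nat -> set T) (c eps : R).
Hypothesis mE : forall n, measurable (E n).
Hypothesis humps : forall n, c <= \int[mu]_t (rnorm (f n t) * \1_(E n) t).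
Hypothesis humps_small : forall j n, (j < n)%N ->
  \int[mu]_t (rnorm (f j t) * \1_(E n) t) <= eps * 2^-1 ^+ n.
Hypothesis eps0 : 0 <= eps.

Let tail n := \bigcup_(j in [set j | (n < j)%N]) E j.
(** Disjoint from one another, and carrying almost all the mass that [f n] has on
    [E n]. *)
Let D n := E n `\` tail n.

Let mtail n : measurable (tail n).
Proof. exact: bigcup_measurable. Qed.

Let mD n : measurable (D n). Proof. exact: measurableD. Qed.

Let D_inj i j t : D i t -> D j t -> i = j.
Proof.
move=> [Ei ti] [Ej tj]; apply/eqP; rewrite eqn_leq; apply/andP; split.
  by rewrite leqNgt; apply/negP => ij; apply: tj; exists i.
by rewrite leqNgt; apply/negP => ij; apply: ti; exists j.
Qed.

Let tail_small n : \int[mu]_t (rnorm (f n t) * \1_(tail n) t) <= 2 * eps.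
Proof.
pose a j t : R := rnorm (f n t) * \1_(E j) t * (n < j)%N%:R.
have a0 j t : 0 <= a j t by rewrite !mulr_ge0 ?rnorm_ge0.
have ai j : itg mu (a j).
  rewrite /a; under [X in itg _ X]eq_fun do rewrite mulrC.
  by apply: itgZ; apply: itgM_indic => //; exact: itg_L1.
have ti : itg mu (fun t => rnorm (f n t) * \1_(tail n) t).
  by apply: itgM_indic => //; exact: itg_L1.
rewrite -lee_fin -int_EFin//.
apply: (@le_trans _ _ (\int[mu]_t \sum_(j <oo) (a j t)%:E)%E).
  apply: ge0_le_integral => //.
  - by move=> t _; rewrite lee_fin mulr_ge0 ?rnorm_ge0.
  - exact/measurable_EFinP/(itg_measurable ti).
  - apply: (@ge0_emeasurable_sum _ _ _ _ (fun j t => (a j t)%:E) xpredT) => [j x _ _|j _].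
      by rewrite lee_fin.
    exact/measurable_EFinP/(itg_measurable (ai j)).
  move=> t _; have [tt|tt] := pselect (tail n t); last first.
    rewrite indicE memNset// mulr0; apply: nneseries_ge0 => j _ _.
    by rewrite lee_fin.
  have [j /= nj Ej] := tt.
  apply: le_trans (nneseries_lim_ge j.+1 _); last by move=> i _ _; rewrite lee_fin.
  rewrite big_nat_recr//= -[leLHS]add0e; apply: leeD.
    by apply: sume_ge0 => i _; rewrite lee_fin.
  by rewrite lee_fin /a nj mulr1 !indicE (mem_set tt) (mem_set Ej).
have ma j : measurable_fun setT (EFin \o a j).
  exact/measurable_EFinP/(itg_measurable (ai j)).
have ea0 j t : (0 <= (a j t)%:E)%E by rewrite lee_fin.
rewrite integral_nneseries//.
under eq_eseriesr do rewrite int_EFin//.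
apply: nneseries_le => [j|N]; first exact: int_ge0.
apply: (@le_trans _ _ (\sum_(0 <= j < N) eps * 2^-1 ^+ j)).
  apply: ler_sum => j _; rewrite /a.
  have [nj|nj] := boolP (n < j)%N.
    by under eq_Rintegral do rewrite mulr1; exact: humps_small.
  under eq_Rintegral do rewrite mulr0.
  by rewrite /Rintegral integral0 mulr_ge0// exprn_ge0// invr_ge0.
by rewrite -mulr_sumr mulrC ler_wpM2r// sum_half.
Qed.

(** The sign with which the hump of [f n] enters the test function: it is chosen so
    that this hump cannot cancel what [f n] gives on the earlier humps. *)
Let sgn_of (H : T -> K) n : R :=
  if 0 <= \int[mu]_t sre k (f n t * H t) then 1 else -1.

Fixpoint hump_test n : T -> K :=
  if n is m.+1 then fun t => hump_test m t +
    sreal k (\1_(D m) t * sgn_of (hump_test m) m) * sphase (f m t)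
  else fun=> 0.

Let H := hump_test.
Let s n := sgn_of (H n) n.
Let S n t : K := sreal k (s n) * sphase (f n t).

Let s_norm n : `|s n| = 1.
Proof. by rewrite /s /sgn_of; case: ifP => _; rewrite ?normrN normr1. Qed.

Let S_le n t : rnorm (S n t) <= 1.
Proof. by rewrite srnormM rnorm_sreal s_norm mul1r rnorm_sphase. Qed.

Let H_ND n t : (forall j, (j < n)%N -> ~ D j t) -> H n t = 0.
Proof.
elim: n => [//|n IH] nD; rewrite /H /= -/H IH; last first.
  by move=> j jn; apply: nD; exact: leqW.
by rewrite indicE memNset ?mul0r ?sreal0 ?mul0r ?addr0//; exact: nD.
Qed.

Let H_D n j t : (j < n)%N -> D j t -> H n t = S j t.
Proof.
elim: n => [//|n IH]; rewrite ltnS leq_eqVlt => /predU1P[jn|jn] Dj.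
  rewrite jn in Dj *; rewrite /H /= -/H H_ND ?add0r; last first.
    by move=> i ni Di; rewrite (D_inj Di Dj) ltnn in ni.
  by rewrite indicE mem_set// mul1r.
rewrite /H /= -/H IH// indicE memNset ?mul0r ?sreal0 ?mul0r ?addr0// => Dn.
by rewrite (D_inj Dj Dn) ltnn in jn.
Qed.

Let mH n : smeasurable (H n).
Proof.
elim: n => [|n IH]; first rewrite /H /=; first split.
- by under eq_fun do rewrite sre0; exact: measurable_cst.
- by under eq_fun do rewrite sim0; exact: measurable_cst.
rewrite /H /= -/H; apply: smeasurableD => //; apply: smeasurableM.
  by apply: smeasurable_sreal; apply: measurable_funM => //; exact: measurable_indic.
by apply: smeasurable_sphase; exact: smeasurable_L1.
Qed.

(** On [D n] the test function is [s n] times the conjugate phase of [f n], and the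
    sets [D n] are disjoint. Against [f n], the later humps contribute at most [2 * eps], the
    hump [D n] contributes [s n * b] with [b >= c - 2 * eps], and the earlier humps
    contribute a number [a] of arbitrary size whose sign is that of [s n]. So the
    absolute value of the total is large for every [n]: no subsequence has to be
    extracted, as one would do with Rosenthal's disjointness lemma. The support
    condition makes the supports escape when the sequence is shifted. *)
Lemma gliding_hump : exists h : T -> K,
  [/\ smeasurable h, (forall t, rnorm (h t) <= 1),
   (forall t, h t != 0 -> exists2 n, E n t & forall j, (n < j)%N -> ~ E j t) &
   forall n, c - 4 * eps <= `|\int[mu]_t sre k (f n t * h t)|].
Proof.
have /choice[idx idxP] t : exists j, (exists i, D i t) -> D j t.
  by have [[i Di]|nD] := pselect (exists i, D i t); [exists i|exists 0%N].
(* [t] lies in at most one [D j], so the partial test functions are stationary at [t] *)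
pose h t : K := H (idx t).+1 t.
have hD j t : D j t -> h t = S j t.
  move=> Dj; have Di : D (idx t) t by apply: idxP; exists j.
  by rewrite /h (H_D (ltnSn _) Di) (D_inj Di Dj).
have hND t : (forall j, ~ D j t) -> h t = 0 by move=> nD; exact: H_ND.
have Hh n t : (idx t < n)%N -> H n t = h t.
  move=> tn; have [[i Di]|nD] := pselect (exists i, D i t).
    have Dx : D (idx t) t by apply: idxP; exists i.
    by rewrite (H_D tn Dx) (hD _ _ Dx).
  have nD' j : ~ D j t by move=> Dj; apply: nD; exists j.
  by rewrite hND// H_ND.
have h1 t : rnorm (h t) <= 1.
  have [[i Di]|nD] := pselect (exists i, D i t); first by rewrite (hD _ _ Di).
  by rewrite hND ?rnorm0// => j Dj; apply: nD; exists j.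
have mh : smeasurable h.
  split.
    apply: (@measurable_fun_cvg _ _ _ _ (fun n t => sre k (H n t))) => [n|t _].
      exact: (mH n).1.
    by apply: cvg_near_cst; exists (idx t).+1 => // n /= /Hh ->.
  apply: (@measurable_fun_cvg _ _ _ _ (fun n t => sim k (H n t))) => [n|t _].
    exact: (mH n).2.
  by apply: cvg_near_cst; exists (idx t).+1 => // n /= /Hh ->.
exists h; split => //.
  move=> t ht; have [[i Di]|nD] := pselect (exists i, D i t).
    have [Ei ti] := Di; exists i => // j ij Ej; apply: ti; by exists j.
  by move: ht; rewrite hND ?eqxx// => j Dj; apply: nD; exists j.
move=> n.
have fi := itg_L1 (f n).
have H1 t : rnorm (H n t) <= 1.
  have [[i [ni Di]]|nD] := pselect (exists i, (i < n)%N /\ D i t).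
    by rewrite (H_D ni Di).
  by rewrite H_ND ?rnorm0// => j jn Dj; apply: nD; exists j.
have ifH (u : T -> K) : smeasurable u -> (forall t, rnorm (u t) <= 1) ->
    itg mu (fun t => sre k (f n t * u t)).
  move=> mu' u1; apply: (itg_parts _ _ (itg_L1 (f n))).1.
    by apply: smeasurableM => //; exact: smeasurable_L1.
  by move=> t; rewrite srnormM ler_piMr ?rnorm_ge0.
have ih := ifH h mh h1; have iH := ifH (H n) (mH n) H1.
have iD := itgM_indic (mD n) fi.
have iT := itgM_indic (mtail n) fi.
pose a := \int[mu]_t sre k (f n t * H n t).
pose b := \int[mu]_t (rnorm (f n t) * \1_(D n) t).
have b0 : 0 <= b by apply: int_ge0 => t; rewrite mulr_ge0 ?rnorm_ge0.
have bc : c - 2 * eps <= b.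
  rewrite lerBlDr (le_trans (humps n))// (le_trans _ (lerD (lexx b) (tail_small n)))//.
  rewrite -intD//; apply: int_le; [exact: itgM_indic|exact: itgD|move=> t].
  rewrite -mulrDr ler_wpM2l ?rnorm_ge0// !indicE.
  have [Et|Et] := pselect (E n t); last first.
    by rewrite memNset// addr_ge0.
  rewrite (mem_set Et).
  have [tt|tt] := pselect (tail n t).
    by rewrite (mem_set tt) lerDr.
  by rewrite (mem_set (conj Et tt : D n t)) lerDl.
have ab : b <= `|a + s n * b|.
  rewrite /s /sgn_of -/a; case: ifP => a0.
    by rewrite mul1r ger0_norm ?addr_ge0// lerDr.
  have {}a0 : a < 0 by rewrite ltNge a0.
  rewrite mulN1r ler0_norm; last by rewrite subr_le0 (le_trans (ltW a0)).
  by rewrite opprB lerDl oppr_ge0 ltW.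
pose r t := sre k (f n t * h t) -
  (sre k (f n t * H n t) + s n * (rnorm (f n t) * \1_(D n) t)).
have ir : itg mu r by apply: itgB => //; apply: itgD => //; exact: itgZ.
have rE : \int[mu]_t sre k (f n t * h t) - (a + s n * b) = \int[mu]_t r t.
  by rewrite /r intB// ?intD// ?intZ//; [exact: itgZ|apply: itgD => //; exact: itgZ].
have r_le : `|\int[mu]_t r t| <= 2 * eps.
  apply: le_trans (int_norm_le ir) _; apply: le_trans (tail_small n).
  apply: int_le => //; first exact: integrable_norm.
  move=> t; rewrite /r.
  have le_f u : rnorm u <= 1 -> `|sre k (f n t * u)| <= rnorm (f n t).
    by move=> u1; rewrite (le_trans (sre_le_rnorm _))// srnormM ler_piMr ?rnorm_ge0.
  have [[i Di]|nD] := pselect (exists i, D i t); last first.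
    have nD' j : ~ D j t by move=> Dj; apply: nD; exists j.
    rewrite hND// H_ND// !mulr0 sre0 indicE memNset// !mulr0 addr0 subrr normr0.
    by rewrite mulr_ge0 ?rnorm_ge0.
  have [ni|in_|ni] := ltngtP n i.
  - (* a later hump *)
    rewrite H_ND; last by move=> j jn Dj; rewrite (D_inj Dj Di) ltnNge (ltnW ni) in jn.
    rewrite mulr0 sre0 indicE memNset; last first.
      by move=> Dn; rewrite (D_inj Dn Di) ltnn in ni.
    rewrite !mulr0 addr0 subr0 indicE mem_set ?mulr1 ?le_f//.
    by have [Ei _] := Di; exists i.
  - rewrite (H_D in_ Di) (hD _ _ Di) indicE memNset; last first.
      by move=> Dn; rewrite (D_inj Dn Di) ltnn in in_.
    by rewrite !mulr0 addr0 subrr normr0 mulr_ge0 ?rnorm_ge0.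
  - rewrite -ni in Di; rewrite (hD _ _ Di) H_ND; last first.
      by move=> j jn Dj; rewrite (D_inj Dj Di) ltnn in jn.
    rewrite mulr0 sre0 add0r indicE mem_set// mulr1 /S mulrCA [f n t * _]mulrC sphaseM.
    rewrite -srealM sre_sreal subrr normr0 mulr_ge0 ?rnorm_ge0//.
have -> : \int[mu]_t sre k (f n t * h t) = (a + s n * b) + \int[mu]_t r t.
  by rewrite -rE addrC subrK.
have := lerB_normD (a + s n * b) (\int[mu]_t r t).
by move: ab bc r_le; lra.
Qed.

End gliding_hump.

(** * Distance of the cluster points to L1 *)

Section cluster_points_are_far.
Context {R : realType} {k : scalars} d {T : measurableType d}.
Local Notation K := (scalarField R k).
Variable mu : {measure set T -> \bar R}.

(** Test functions whose supports escape to the empty set are asymptotically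
    orthogonal to any fixed element. *)
Lemma escaping_test_functions (g : L1 k mu) (h : nat -> T -> K) :
  (forall m, smeasurable (h m)) -> (forall m t, rnorm (h m t) <= 1) ->
  (forall t, exists N, forall m, (N <= m)%N -> h m t = 0) ->
  (\int[mu]_t sre k (g t * h m t)) @[m --> \oo] --> (0 : R).
Proof.
move=> mh h1 h0.
have mgh m : measurable_fun setT (fun t => sre k (g t * h m t)).
  exact: (smeasurableM (smeasurable_L1 g) (mh m)).1.
have := @dominated_convergence _ _ _ mu setT measurableT
  (fun m t => (sre k (g t * h m t))%:E) (cst 0%E) (fun t => (rnorm (g t))%:E).
case.
- by move=> m; exact/measurable_EFinP.
- exact: measurable_cst.
- apply: aeW => t _; have [N hN] := h0 t; apply: cvg_near_cst.
  by exists N => // m /= /hN ->; rewrite mulr0 sre0.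
- exact: itg_L1.
- apply: aeW => t m _; rewrite /= lee_fin (le_trans (sre_le_rnorm _))//.
  by rewrite srnormM ler_piMr ?rnorm_ge0.
by move=> _ _; rewrite integral0 => /fine_cvg.
Qed.

(** The gliding hump lemma is applied to the sequence shifted by [m]. The resulting
    functional is at least [c - 4 * eps] in absolute value at all terms from the
    [m]-th on, hence at [z], while its value at [g] tends to 0 with [m]. *)
Lemma humps_dist_clust (f : nat -> L1 k mu) (E : nat -> set T) (c eps : R)
    (z : dual (dual (L1 k mu))) (g : L1 k mu) :
  (forall n, measurable (E n)) ->
  (forall n, c <= \int[mu]_t (rnorm (f n t) * \1_(E n) t)) ->
  (forall j n, (j < n)%N ->
    \int[mu]_t (rnorm (f j t) * \1_(E n) t) <= eps * 2^-1 ^+ n) ->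
  0 <= eps -> clust f z -> c - 4 * eps <= rnorm (z - bidual_emb g).
Proof.
move=> mE humps small eps0 fz.
have /choice[h hP] m : exists h : T -> K,
  [/\ smeasurable h, (forall t, rnorm (h t) <= 1),
   (forall t, h t != 0 ->
     exists2 n, E (m + n)%N t & forall j, (n < j)%N -> ~ E (m + j)%N t) &
   forall n, c - 4 * eps <= `|\int[mu]_t sre k (f (m + n)%N t * h t)|].
  apply: (@gliding_hump _ _ _ _ mu (fun n => f (m + n)%N) (fun n => E (m + n)%N)) => //.
  move=> j n jn; rewrite (le_trans (small _ _ _)) ?ltn_add2l//.
  rewrite ler_wpM2l// exprD ler_piMl ?exprn_ge0 ?invr_ge0// exprn_ile1 ?invr_ge0//.
  by rewrite invf_le1 ?ler1n.
have h0 t : exists N, forall m, (N <= m)%N -> h m t = 0.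
  have [[N EN]|nE] := pselect (exists N, forall n, (N <= n)%N -> ~ E n t).
    exists N => m Nm; apply/eqP/negPn/negP => hmt.
    have [_ _ /(_ t hmt)[n En _] _] := hP m.
    by apply: EN En; rewrite (leq_trans Nm)// leq_addr.
  exists 0%N => m _; apply/eqP/negPn/negP => hmt.
  have [_ _ /(_ t hmt)[n _ En] _] := hP m.
  apply: nE; exists (m + n).+1 => j mnj Ej.
  have mj : (m <= j)%N by rewrite (leq_trans _ mnj)// leqW// leq_addr.
  by apply: (En (j - m)%N); rewrite ?subnKC// ltn_subRL.
apply/ler_addgt0Pr => e e0; have e2 : 0 < e / 2 by rewrite divr_gt0.
have := @escaping_test_functions g h (fun m => let: And4 a _ _ _ := hP m in a)
  (fun m => let: And4 _ a _ _ := hP m in a) h0.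
move/cvgrPdist_lt => /(_ _ e2)[m _ /(_ m (leqnn m))]; rewrite /= sub0r normrN => gm.
have [mh h1 _ hf] := hP m.
have [phi phi1 phiE] := L1_pairing mu mh h1.
have [n mn zn] := clust_frequently phi m fz e2.
have := hf (n - m)%N; rewrite subnKC// -phiE => fn.
have zg : rnorm (z phi - phi g) <= rnorm (z - bidual_emb g).
  rewrite -[X in rnorm X]/((z - bidual_emb g) phi) (le_trans (dual_normP _ _))//.
  by rewrite !rnorm_dualE ler_piMr// dual_norm_ge0.
have := sre_le_rnorm (z phi - phi g); rewrite sreD sreN phiE => h2.
have := sre_le_rnorm (z phi - phi (f n)); rewrite sreD sreN => h3.
move: fn gm h2 h3 zn zg.
set p := sre k (phi (f n)); set q := \int[mu]_t _; set zz := sre k (z phi).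
move=> fn gm h2 h3 zn zg.
have := lerB_normD zz (- q); rewrite normrN => h4.
have := ler_normD zz (p - zz); rewrite [zz + _]addrC subrK (distrC p) => h5.
lra.
Qed.

(** Elements of [A] that are not uniformly dominated give humps: each new element
    is chosen to overshoot a huge multiple of the sum of all earlier ones, so on
    the set where it overshoots the earlier ones are tiny. *)
Lemma humps_exist (A : set (L1 k mu)) (M c eps : R) :
  (forall f, A f -> rnorm f <= M) -> 0 < eps ->
  (forall g : T -> R, (forall t, 0 <= g t) -> itg mu g ->
    exists2 f, A f & c <= \int[mu]_t Num.max (rnorm (f t) - g t) 0) ->
  exists (f : nat -> L1 k mu) (E : nat -> set T),
  [/\ forall n, A (f n), forall n, measurable (E n),
    forall n, c <= \int[mu]_t (rnorm (f n t) * \1_(E n) t) &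
    forall j n, (j < n)%N ->
      \int[mu]_t (rnorm (f j t) * \1_(E n) t) <= eps * 2^-1 ^+ n].
Proof.
move=> AM eps0 Ac.
have /choice[F FP] (g : T -> R) : exists f, (forall t, 0 <= g t) -> itg mu g ->
    A f /\ c <= \int[mu]_t Num.max (rnorm (f t) - g t) 0.
  have [[g0 gi]|ng] := pselect ((forall t, 0 <= g t) /\ itg mu g).
    by have [f Af cf] := Ac g g0 gi; exists f.
  by exists 0 => g0 gi; exfalso; apply: ng.
pose N n : R := (`|M| + 1) * 2 ^+ n / eps.
have M1 : 0 < `|M| + 1 by rewrite ltr_wpDl.
have N0 n : 0 < N n by rewrite !(divr_gt0, mulr_gt0, exprn_gt0).
pose S := fix S n : T -> R := if n is m.+1 then
  fun t => S m t + rnorm (F (fun t => N m * S m t) t) else fun=> 0.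
pose g n t := N n * S n t.
pose f n := F (g n).
have SS n t : S n.+1 t = S n t + rnorm (f n t) by [].
have S0 n t : 0 <= S n t.
  by elim: n => [//|n IH]; rewrite SS addr_ge0// rnorm_ge0.
have Si n : itg mu (S n).
  by elim: n => [|n IH]; [exact: itg0|apply: itgD => //; exact: itg_L1].
have g0 n t : 0 <= g n t by rewrite mulr_ge0// ltW.
have gi n : itg mu (g n) by exact: itgZ.
pose E n := [set t | g n t < rnorm (f n t)].
have mE n : measurable (E n).
  rewrite (_ : E n = ~` [set t | rnorm (f n t) <= g n t]).
    apply: measurableC; apply: measurable_leset; last exact: itg_measurable (gi n).
    exact/smeasurable_rnorm/smeasurable_L1.
  by apply/seteqP; split => t; rewrite /E /= ltNge => /negP.
have fS j n t : (j < n)%N -> rnorm (f j t) <= S n t.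
  elim: n => [//|n IH]; rewrite ltnS leq_eqVlt SS => /predU1P[->|jn].
    by rewrite lerDr.
  by rewrite (le_trans (IH jn))// lerDl rnorm_ge0.
exists f, E; split => //.
- by move=> n; have [] := FP (g n) (g0 n) (gi n).
- move=> n; have [_ cf] := FP (g n) (g0 n) (gi n); apply: (le_trans cf).
  apply: int_le.
  + by apply: itg_max; [exact: itgB (itg_L1 _) (gi n)|exact: itg0].
  + by apply: itgM_indic => //; exact: itg_L1.
  + move=> t; rewrite -/(f n) indicE; have [Et|Et] := pselect (E n t).
      by rewrite mem_set// mulr1 ge_max rnorm_ge0 andbT lerBlDr lerDl.
    rewrite memNset// mulr0 ge_max lexx andbT subr_le0 leNgt.
    exact/negP.
- move=> j n jn.
  have h : N n * \int[mu]_t (rnorm (f j t) * \1_(E n) t) <= `|M| + 1.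
    have i1 := itgM_indic (mE n) (itg_L1 (f j)).
    have [Af _] := FP (g n) (g0 n) (gi n).
    rewrite -intZ// (@le_trans _ _ (rnorm (f n)))//; last first.
      by rewrite (le_trans (AM _ Af))// (le_trans (ler_norm M))// lerDl.
    rewrite rnorm_L1E; apply: int_le; [exact: itgZ|exact: itg_L1|move=> t].
    rewrite indicE; have [Et|Et] := pselect (E n t).
      rewrite mem_set// mulr1 (le_trans _ (ltW Et))// ler_wpM2l ?(ltW (N0 n))//.
      exact: fS.
    by rewrite memNset// !mulr0 rnorm_ge0.
  have -> : eps * 2^-1 ^+ n = (`|M| + 1) / N n.
    by rewrite /N exprVn; field; rewrite !gt_eqF ?exprn_gt0.
  by rewrite ler_pdivlMr// mulrC.
Qed.

(** If [c < omega A], no order interval is within [c] of [A], so [A] contains humps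
    of mass [c]. *)
Lemma omega_le_wck (A : set (L1 k mu)) : bounded_set A -> (omega A <= wck A)%E.
Proof.
move=> /bounded_rnorm[M AM].
have key (c : R) : (c%:E < omega A)%E -> (c%:E <= wck A)%E.
  move=> cA.
  have Ac (g : T -> R) : (forall t, 0 <= g t) -> itg mu g ->
      exists2 f, A f & c <= \int[mu]_t Num.max (rnorm (f t) - g t) 0.
    move=> g0 gi.
    have : (c%:E < hatdist A (order_interval g))%E.
      apply: (lt_le_trans cA); apply: ereal_inf_lbound.
      exists (order_interval g) => //; split.
        by exists 0; exact: order_interval0.
      exact: order_interval_weakly_compact.
    move=> /ereal_sup_gt[_ [f Af <-] cf]; exists f => //.
    rewrite -lee_fin (le_trans (ltW cf))//; exact: setdist_order_interval.
  apply/lee_addgt0Pr => e e0.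
  have e4 : 0 < e / 4 by rewrite divr_gt0.
  have [f [E [fA mE humps small]]] := humps_exist AM e4 Ac.
  rewrite -leeBlDr// -EFinB.
  apply: (@le_trans _ _ (setdist (clust f) (range (@bidual_emb R k (L1 k mu))))).
    apply: setdist_ge => z _ fz [g _ <-]; rewrite lee_fin.
    rewrite (_ : e = 4 * (e / 4)); last by field.
    exact: humps_dist_clust mE humps small (ltW e4) fz.
  by apply: ereal_sup_ubound; exists f.
case E : (omega A) => [x| |]; rewrite ?leNye//.
  apply/lee_addgt0Pr => e e0; rewrite -leeBlDr// -EFinB; apply: key.
  by rewrite E lte_fin ltrBlDr ltrDl.
have : forall r : R, (r%:E <= wck A)%E by move=> r; apply: key; rewrite E ltry.
case: (wck A) => [r| |] h //.
  by have := h (r + 1); rewrite lee_fin gerDl ler10.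
by have := h 0.
Qed.

End cluster_points_are_far.

Theorem theorem7p5 (R : realType) (k : scalars) (d : measure_display)
    (T : measurableType d) (mu : {measure set T -> \bar R})
    (A : set (L1 k mu)) (hA : bounded_set A) :
  omega A = wk A /\ wk A = wck A.
Proof.
have h1 := wck_le_wk hA; have h2 := wk_le_omega A; have h3 := omega_le_wck hA.
split; apply/eqP; rewrite eq_le.
  by rewrite h2 (le_trans h3 h1).
by rewrite h1 (le_trans h2 h3).
Qed.
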